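(* SPFG-$2K_2$-Free-Deletion admits an algorithm that runs in $2^{|X|}n^{{\mathcal O}(1)}$-time.
   Context: SPFG-$2K_2$-Free-Deletion: the input is a simple, undirected graph $G=(V,E)$ with $n$ vertices, two distinct vertices $s,t\in V(G)$, a forcing graph $G_f=(E,E')$ whose vertex set is the edge set of $G$, a set $X\subseteq V(G_f)$ such that $G_f-X$ is $2K_2$-free (contains no two edges that are nonadjacent, i.e. no induced matching of size two), and an integer $\ell$. The question is whether there is $E^*\subseteq E$ with at most $\ell$ edges such that the subgraph $(V,E^* )$ contains an $s$-$t$ path and $E^*$ is a vertex cover of $G_f$. The parameter is $|X|$. *)

(* Defs.v *)
From HB Require Import structures.
From mathcomp Require Import all_boot all_order all_algebra.

Set Implicit Arguments.
Unset Strict Implicit.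
Unset Printing Implicit Defensive.

Record sgraph (V : finType) := SGraph {
  adj :> rel V;
  adj_sym : symmetric adj;
  adj_irr : irreflexive adj
}.

Definition edges (V : finType) (G : sgraph V) : {set {set V}} :=
  [set [set p.1; p.2] | p : V * V & G p.1 p.2].

Definition edge (V : finType) (G : sgraph V) : finType :=
  {e : {set V} | e \in edges G}.

Definition ends (V : finType) (G : sgraph V) (e : edge G) : {set V} := sval e.

Definition del_rel (V : finType) (G : sgraph V) (X : {set V}) :
  rel {x : V | x \notin X} := fun x y => G (val x) (val y).

Lemma del_sym (V : finType) (G : sgraph V) (X : {set V}) :
  symmetric (@del_rel V G X).
Proof. by move=> x y; apply: adj_sym. Qed.

Lemma del_irr (V : finType) (G : sgraph V) (X : {set V}) :
  irreflexive (@del_rel V G X).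
Proof. by move=> x; apply: adj_irr. Qed.

Definition del (V : finType) (G : sgraph V) (X : {set V}) :
  sgraph {x : V | x \notin X} := SGraph (@del_sym V G X) (@del_irr V G X).

Definition two_K2_free (V : finType) (G : sgraph V) : Prop :=
  ~ exists a b c d : V,
      [/\ uniq [:: a; b; c; d], G a b, G c d
        & [&& ~~ G a c, ~~ G a d, ~~ G b c & ~~ G b d]].

Definition vertex_cover (V : finType) (G : sgraph V) (C : {set V}) : Prop :=
  forall x y : V, G x y -> (x \in C) || (y \in C).

(* Adjacency in the spanning subgraph (V, Es) of G. *)
Definition sub_adj (V : finType) (G : sgraph V) (Es : {set edge G}) : rel V :=
  fun u v => [exists e in Es, ends e == [set u; v]].

Record instance := Instance {
  nverts : nat;
  graph : sgraph 'I_nverts;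
  source : 'I_nverts;
  target : 'I_nverts;
  source_neq_target : source != target;
  forcing : sgraph (edge graph);
  modulator : {set edge graph};
  modulatorP : two_K2_free (del forcing modulator);
  budget : int
}.

Definition yes_instance (I : instance) : Prop :=
  exists Es : {set edge (graph I)},
    [/\ (#|Es|%:Z <= budget I)%R,
        connect (sub_adj Es) (source I) (target I)
      & vertex_cover (forcing I) Es].

(* Machine model: a random access machine presented as a structured language.
   A state has natural-number variables and unbounded natural-number arrays,
   both named by numerals; a program, being finite, mentions only finitely many
   of them, so they can be interleaved in a single memory at constant-factor
   cost.  Every syntax node evaluated costs one unit.  The arithmetic is limited
   to addition and truncated subtraction: at unit cost, multiplication would
   build numbers of exponential bit length, whereas here a value gains at most
   one bit per unit of time, so time is polynomially related to that of Turing
   machines. *)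
Inductive expr :=
  | Const of nat
  | Var of nat
  | Read of nat & expr
  | Add of expr & expr
  | Sub of expr & expr.

Inductive cmd :=
  | Skip
  | Assign of nat & expr
  | Store of nat & expr & expr
  | Seq of cmd & cmd
  | If of expr & cmd & cmd
  | While of expr & cmd.

Record state := State { var : nat -> nat; arr : nat -> nat -> nat }.

Definition set_var (x v : nat) (s : state) : state :=
  State (fun y => if y == x then v else var s y) (arr s).

Definition set_arr (a i v : nat) (s : state) : state :=
  State (var s)
    (fun b j => if (b == a) && (j == i) then v else arr s b j).

Fixpoint eval (s : state) (e : expr) : nat :=
  match e with
  | Const k => k
  | Var x => var s x
  | Read a e1 => arr s a (eval s e1)
  | Add e1 e2 => eval s e1 + eval s e2
  | Sub e1 e2 => eval s e1 - eval s e2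
  end.

Fixpoint cost (e : expr) : nat :=
  match e with
  | Const _ | Var _ => 1
  | Read _ e1 => (cost e1).+1
  | Add e1 e2 | Sub e1 e2 => (cost e1 + cost e2).+1
  end.

(* [exec c s t s']: started in s, c halts in s' after t units of time.
   A guard is true when its value is nonzero. *)
Inductive exec : cmd -> state -> nat -> state -> Prop :=
  | exec_skip s : exec Skip s 1 s
  | exec_assign x e s :
      exec (Assign x e) s (cost e).+1 (set_var x (eval s e) s)
  | exec_store a i e s :
      exec (Store a i e) s (cost i + cost e).+1
        (set_arr a (eval s i) (eval s e) s)
  | exec_seq c1 c2 s t1 s1 t2 s2 :
      exec c1 s t1 s1 -> exec c2 s1 t2 s2 ->
      exec (Seq c1 c2) s (t1 + t2).+1 s2
  | exec_if_true e c1 c2 s t s' :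
      eval s e != 0 -> exec c1 s t s' ->
      exec (If e c1 c2) s (cost e + t).+1 s'
  | exec_if_false e c1 c2 s t s' :
      eval s e = 0 -> exec c2 s t s' ->
      exec (If e c1 c2) s (cost e + t).+1 s'
  | exec_while_false e c s :
      eval s e = 0 -> exec (While e c) s (cost e).+1 s
  | exec_while_true e c s t1 s1 t2 s2 :
      eval s e != 0 -> exec c s t1 s1 -> exec (While e c) s1 t2 s2 ->
      exec (While e c) s (cost e + t1 + t2).+1 s2.

(* The edges of G are numbered 0, ..., m-1 in the order of [enum].  The budget
   is given by its sign and its absolute value, as machine words are natural
   numbers. *)
Definition input_vars (I : instance) : seq nat :=
  [:: nverts I; nat_of_ord (source I); nat_of_ord (target I);
      #|edge (graph I)|; nat_of_bool (budget I < 0)%R; `|budget I|%N].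

(* Array 0: the endpoints of edge i, at indices 2i and 2i+1.
   Array 1: the indicator of X.
   Array 2: the m x m adjacency matrix of G_f, in row-major order. *)
Definition input_arrs (I : instance) : seq (seq nat) :=
  let es := enum (edge (graph I)) in
  [:: flatten [seq [seq nat_of_ord v | v <- enum (ends e)] | e <- es];
      [seq nat_of_bool (e \in modulator I) | e <- es];
      [seq nat_of_bool (forcing I e f) | e <- es, f <- es]].

(* Variables and cells outside the input are initially 0. *)
Definition input (I : instance) : state :=
  State (nth 0 (input_vars I)) (fun a => nth 0 (nth [::] (input_arrs I) a)).

Definition accepting (s : state) : Prop := var s 0 = 1.
Definition rejecting (s : state) : Prop := var s 0 = 0.

(* P answers correctly on I and halts within T units of time. *)
Definition solves_within (P : cmd) (I : instance) (T : nat) : Prop :=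
  exists t s,
    [/\ exec P (input I) t s, t <= T,
        yes_instance I -> accepting s
      & ~ yes_instance I -> rejecting s].

(* Main.v *)
(* A set E* of edges is a solution iff its complement is independent in G_f and
   enough edges remain to connect s and t. Guess the part Z of the complement
   inside X; there are 2^|X| guesses. The rest of the complement lies in a maximal
   independent set A of the 2K_2-free graph G_f - X, and A is determined by two
   vertices u, v: below v it consists of the common non-neighbours of u and v, and
   above v it is the greedy extension. For each guess (Z, u, v), take
   F = E \ (Z + (A - N(Z))); when F is a vertex cover, the cheapest solution
   containing F is F plus a shortest s-t path in which the edges of F are free.

   The program is written with bounded loops only, so it denotes a total function
   on states and its running time is a syntactic polynomial in the loop bounds. *)

Require Import Defs.
From HB Require Import structures.
From mathcomp Require Import all_boot all_order all_algebra.
From mathcomp Require Import zify.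

Set Implicit Arguments.
Unset Strict Implicit.
Unset Printing Implicit Defensive.

(** * Programs with bounded loops *)

(* [Sub] is shadowed by [eqtype.Sub]. *)
Local Notation ESub := Defs.Sub.

(** Only completeness uses that G_f - X is 2K_2-free. Each round tests explicitly that F is a vertex
    cover, that t is reached and that the budget suffices, so a wrong guess never causes a false
    yes, and it is enough that one guess works. It is read off a solution: the complement of the
    solution is independent, so its part outside X avoids N(Z) and survives in A - N(Z). Hence F
    lies inside the solution, and Z + (A - N(Z)) is independent. The obstacle is finding A: listing
    the maximal independent sets would need an enumeration procedure of its own. The pair (u, v)
    replaces it by a rule evaluated in one pass over the edges, at the price of two loops. *)

Inductive prog :=
  | PAssign of nat & expr
  | PStore of nat & expr & expr
  | PSeq of prog & prog
  | PIf of expr & prog & prog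
  | PFor of nat & nat & prog.

Fixpoint compile (p : prog) : cmd :=
  match p with
  | PAssign x e => Assign x e
  | PStore a i e => Store a i e
  | PSeq p q => Seq (compile p) (compile q)
  | PIf e p q => If e (compile p) (compile q)
  | PFor x b p =>
      Seq (Assign x (Const 0))
        (While (ESub (Var b) (Var x))
          (Seq (compile p) (Assign x (Add (Var x) (Const 1)))))
  end.

Fixpoint den (p : prog) (s : state) : state :=
  match p with
  | PAssign x e => set_var x (eval s e) s
  | PStore a i e => set_arr a (eval s i) (eval s e) s
  | PSeq p q => den q (den p s)
  | PIf e p q => if eval s e != 0 then den p s else den q s
  | PFor x b p =>
      iteri (var s b) (fun i s => set_var x i.+1 (den p s)) (set_var x 0 s)
  end.

Arguments eval : simpl never.
Arguments den : simpl never.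

Fixpoint mod_vars (p : prog) : seq nat :=
  match p with
  | PAssign x _ => [:: x]
  | PStore _ _ _ => [::]
  | PSeq p q | PIf _ p q => mod_vars p ++ mod_vars q
  | PFor x _ p => x :: mod_vars p
  end.

Fixpoint mod_arrs (p : prog) : seq nat :=
  match p with
  | PAssign _ _ => [::]
  | PStore a _ _ => [:: a]
  | PSeq p q | PIf _ p q => mod_arrs p ++ mod_arrs q
  | PFor _ _ p => mod_arrs p
  end.

(* B lists the variables holding loop bounds: no assignment touches them, so the
   bounds can be read off the initial state. *)
Fixpoint wf (B : seq nat) (p : prog) : bool :=
  match p with
  | PAssign x _ => x \notin B
  | PStore _ _ _ => true
  | PSeq p q | PIf _ p q => wf B p && wf B q
  | PFor x b p => [&& x \notin B, b \in B, x \notin mod_vars p & wf B p]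
  end.

(* f gives the values of the loop bounds; 9 and 7 pay for the guard, the
   increment and the initialisation of a compiled loop. *)
Fixpoint time (f : nat -> nat) (p : prog) : nat :=
  match p with
  | PAssign _ e => (cost e).+1
  | PStore _ i e => (cost i + cost e).+1
  | PSeq p q => (time f p + time f q).+1
  | PIf e p q => (cost e + (time f p + time f q)).+1
  | PFor _ b p => f b * (time f p + 9) + 7
  end.

Fixpoint depth (p : prog) : nat :=
  match p with
  | PAssign _ _ | PStore _ _ _ => 0
  | PSeq p q | PIf _ p q => maxn (depth p) (depth q)
  | PFor _ _ p => (depth p).+1
  end.

Lemma var_set x v s : var (set_var x v s) x = v.
Proof. by rewrite /= eqxx. Qed.

Lemma denAssign x e s : den (PAssign x e) s = set_var x (eval s e) s.
Proof. by []. Qed.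

Lemma denStore a i e s :
  den (PStore a i e) s = set_arr a (eval s i) (eval s e) s.
Proof. by []. Qed.

Lemma denSeq p q s : den (PSeq p q) s = den q (den p s).
Proof. by []. Qed.

Lemma denIf e p q s :
  den (PIf e p q) s = if eval s e != 0 then den p s else den q s.
Proof. by []. Qed.

Lemma denFor x b p s :
  den (PFor x b p) s =
  iteri (var s b) (fun i s => set_var x i.+1 (den p s)) (set_var x 0 s).
Proof. by []. Qed.

Opaque den.

Definition denE := (denAssign, denStore, denSeq, denIf).

Lemma iteri_ind (T : Type) (Q : nat -> T -> Prop) n (f : nat -> T -> T) z :
  Q 0 z -> (forall i z, i < n -> Q i z -> Q i.+1 (f i z)) -> Q n (iteri n f z).
Proof.
move=> Q0 QS; elim: n QS => [//|n IHn] QS /=.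
by apply: (QS n) => //; apply: IHn => i y lt_in; apply/QS/ltnW.
Qed.

Lemma den_var p s x : x \notin mod_vars p -> var (den p s) x = var s x.
Proof.
elim: p s => [y e|a i e|p IHp q IHq|e p IHp q IHq|y b p IHp] s /=.
- by rewrite inE => /negPf xy; rewrite denE /= xy.
- by rewrite denE.
- by rewrite mem_cat => /norP[Hp Hq]; rewrite denE IHq ?IHp.
- by rewrite mem_cat => /norP[Hp Hq]; rewrite denE; case: ifP; auto.
- rewrite inE => /norP[/negPf xy Hp].
  rewrite denFor.
  apply: (@iteri_ind _ (fun _ z => var z x = var s x)) => [|i z _ Hz] /=;
  by rewrite xy // IHp.
Qed.

Lemma den_arr p s a i : a \notin mod_arrs p -> arr (den p s) a i = arr s a i.
Proof.
elim: p s => [y e|b j e|p IHp q IHq|e p IHp q IHq|y b p IHp] s /=.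
- by rewrite denE.
- by rewrite inE => /negPf xy; rewrite denE /= xy.
- by rewrite mem_cat => /norP[Hp Hq]; rewrite denE IHq ?IHp.
- by rewrite mem_cat => /norP[Hp Hq]; rewrite denE; case: ifP; auto.
- move=> Hp.
  rewrite denFor.
  apply: (@iteri_ind _ (fun _ z => arr z a i = arr s a i)) => [|k z _ Hz] //=.
  by rewrite IHp.
Qed.

Lemma wf_var B p x : wf B p -> x \in B -> x \notin mod_vars p.
Proof.
move=> + xB; elim: p => [y e|a i e|p IHp q IHq|e p IHp q IHq|y b p IHp] //=.
- by rewrite inE; apply: contra => /eqP <-.
- by case/andP => /IHp Hp /IHq Hq; rewrite mem_cat negb_or Hp.
- by case/andP => /IHp Hp /IHq Hq; rewrite mem_cat negb_or Hp.
- case/and4P => yB _ _ /IHp Hp; rewrite inE negb_or Hp andbT.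
  by apply: contra yB => /eqP <-.
Qed.

(** A compiled loop rereads its bound at every guard. As [wf] keeps the body away from bounds and
    counter, [While] makes exactly the rounds prescribed by [iteri]. *)
Lemma exec_compile B (f : nat -> nat) p s :
  wf B p -> {in B, forall b, var s b = f b} ->
  exists2 t, t <= time f p & exec (compile p) s t (den p s).
Proof.
elim: p s => [x e|a i e|p IHp q IHq|e p IHp q IHq|x b p IHp] s /=.
- by move=> _ _; exists (cost e).+1 => //; constructor.
- by move=> _ _; exists (cost i + cost e).+1 => //; constructor.
- case/andP => Wp Wq sB; have [t1 le1 ex1] := IHp s Wp sB.
  have [|t2 le2 ex2] := IHq (den p s) Wq.
    by move=> b bB; rewrite den_var ?sB //; apply: wf_var bB.
  exists (t1 + t2).+1; first by rewrite ltnS leq_add.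
  exact: exec_seq ex1 ex2.
- case/andP => Wp Wq sB; rewrite denE; case: ifPn => [He|/negPn/eqP He].
    have [t1 le1 ex1] := IHp s Wp sB.
    exists (cost e + t1).+1; last exact: exec_if_true.
    by rewrite ltnS leq_add2l (leq_trans le1) ?leq_addr.
  have [t1 le1 ex1] := IHq s Wq sB.
  exists (cost e + t1).+1; last exact: exec_if_false.
  by rewrite ltnS leq_add2l (leq_trans le1) ?leq_addl.
- case/and4P => xB bB xp Wp sB.
  pose g i z := set_var x i.+1 (den p z); pose z0 := set_var x 0 s.
  have invB i z : {in B, forall b, var z b = f b} ->
      {in B, forall b, var (g i z) b = f b}.
    move=> zB c cB; rewrite /=; case: eqP => [cx|_].
      by rewrite -cx cB in xB.
    by rewrite den_var ?zB //; apply: wf_var cB.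
  have z0B : {in B, forall b, var z0 b = f b}.
    move=> c cB; rewrite /=; case: eqP => [cx|_]; first by rewrite -cx cB in xB.
    exact: sB.
  (* [i] rounds are done and [k] remain; the 4 pays for the guard that finally fails. *)
  have loop k i z :
     {in B, forall b, var z b = f b} -> var z x = i -> i + k = f b ->
     exists2 t, t <= k * (time f p + 9) + 4 &
       exec (While (ESub (Var b) (Var x))
                (Seq (compile p) (Assign x (Add (Var x) (Const 1)))))
            z t (iteri k (fun j => g (i + j)) z).
    elim: k i z => [|k IHk] i z zB zx ik /=.
      exists 4 => //; apply: (@exec_while_false (ESub (Var b) (Var x))).
      by rewrite /eval zB // zx -ik addn0 subnn.
    have [t1 le1 ex1] := IHp z Wp zB.
    have [||| t2 le2 ex2] := IHk i.+1 (g i z); first exact: invB.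
    - by rewrite /= eqxx.
    - by rewrite addSnnS.
    exists (3 + (t1 + 4).+1 + t2).+1; first by lia.
    (* Execution peels off the first round, [iteri] the last one. *)
    suff -> : g (i + k) (iteri k (fun j => g (i + j)) z) =
              iteri k (fun j => g (i.+1 + j)) (g i z).
      apply: (@exec_while_true (ESub (Var b) (Var x))) ex2.
        by rewrite /eval zB // zx -ik; lia.
      apply: exec_seq ex1 _.
      have -> : g i z =
          set_var x (eval (den p z) (Add (Var x) (Const 1))) (den p z).
        by rewrite /eval den_var // zx addn1.
      exact: (exec_assign x (Add (Var x) (Const 1))).
    elim: k {IHk ik le2 ex2} => [|k IHk]; first by rewrite addn0.
    by rewrite /= IHk addSnnS.
  have [|t le_t ext] := loop (f b) 0 z0 z0B _ (add0n _); first by rewrite /= eqxx.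
  exists (2 + t).+1; first by lia.
  have -> : den (PFor x b p) s = iteri (f b) (fun i => g (0 + i)) z0.
    by rewrite denFor (sB b bB).
  exact: exec_seq (exec_assign x (Const 0) s) ext.
Qed.

(** Each level of nesting costs one factor [N]; the time with unit bounds collects all constants.
    Both can be computed from the syntax. *)
Lemma time_depth (f : nat -> nat) N p : 0 < N -> (forall b, f b <= N) ->
  time f p <= time (fun=> 1) p * N ^ depth p.
Proof.
move=> N0 fN.
elim: p => [x e|a i e|p IHp q IHq|e p IHp q IHq|x b p IHp] /=.
- by rewrite muln1.
- by rewrite muln1.
- have Hp : N ^ depth p <= N ^ maxn (depth p) (depth q).
    by rewrite leq_pexp2l ?leq_maxl.
  have Hq : N ^ depth q <= N ^ maxn (depth p) (depth q).
    by rewrite leq_pexp2l ?leq_maxr.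
  have H0 : 0 < N ^ maxn (depth p) (depth q) by rewrite expn_gt0 N0.
  by nia.
- have Hp : N ^ depth p <= N ^ maxn (depth p) (depth q).
    by rewrite leq_pexp2l ?leq_maxl.
  have Hq : N ^ depth q <= N ^ maxn (depth p) (depth q).
    by rewrite leq_pexp2l ?leq_maxr.
  have H0 : 0 < N ^ maxn (depth p) (depth q) by rewrite expn_gt0 N0.
  by nia.
- have H0 : 0 < N ^ depth p by rewrite expn_gt0 N0.
  rewrite expnS mul1n -addnA mulnDl.
  have := leq_mul (fN b) (leqnn (time f p + 9)).
  by nia.
Qed.

(** Invariant rule for loops. The counter is set outside the body, so [Q] must be blind to it; frame
    facts are handed to the body, so [Q] need not carry them. *)
Lemma den_for (Q : nat -> state -> Prop) x b p s :
  x \notin mod_vars p ->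
  (forall i k z, Q i z -> Q i (set_var x k z)) -> Q 0 s ->
  (forall i z, i < var s b -> var z x = i ->
     (forall y, y \notin x :: mod_vars p -> var z y = var s y) ->
     (forall a j, a \notin mod_arrs p -> arr z a j = arr s a j) ->
     Q i z -> Q i.+1 (den p z)) ->
  Q (var s b) (den (PFor x b p) s).
Proof.
move=> xp Qx Q0 QS.
pose P i z := [/\ var z x = i,
  forall y, y \notin x :: mod_vars p -> var z y = var s y,
  forall a j, a \notin mod_arrs p -> arr z a j = arr s a j & Q i z].
suff [] : P (var s b) (den (PFor x b p) s) by [].
rewrite denFor; apply: (@iteri_ind _ P) => [|i z lt_i [zx zv za Qz]]; split => //=.
- by rewrite eqxx.
- by move=> y; rewrite inE => /norP[/negPf->].
- exact: Qx.
- by rewrite eqxx.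
- move=> y y_x; have := y_x; rewrite inE => /norP[/negPf-> yp].
  by rewrite den_var // zv.
- by move=> a j ap; rewrite den_arr // za.
- exact/Qx/QS.
Qed.

(** * Maximal independent sets of 2K_2-free graphs *)

(** An equation instead of a recursion: the right-hand side consults [A] only below [w], so it
    determines [A], and it can be checked cell by cell on an array filled in increasing order. *)
Definition greedy m (e : rel 'I_m) (al : pred 'I_m) (u v : 'I_m) (A : pred 'I_m) :=
  forall w, A w = al w &&
    [|| [&& w < v, ~~ e w u & ~~ e w v], w == v
      | (v < w) && [forall y : 'I_m, (y < w) && A y ==> ~~ e y w]].

(* Consider the least i such that J meets every later initial segment [0, j),
   j >= i, in a maximal independent set. If i > 0, then v = i - 1 lies in J and
   some neighbour u < v of v has no neighbour in J below v. Hence J coincides below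
   v with the common non-neighbours of u and v: an edge from J to a missing one
   would form a 2K_2 with uv. Above v, maximality on every segment forces J to be
   greedy. If i = 0, the greedy rule alone already yields J. *)
Lemma max_indep_greedy m (e : rel 'I_m) (al J : pred 'I_m) :
  0 < m -> symmetric e -> irreflexive e ->
  (forall a b c d, al a -> al b -> al c -> al d -> e a b -> e c d ->
     [|| e a c, e a d, e b c | e b d]) ->
  (forall w, J w -> al w) ->
  (forall y w, J y -> J w -> ~~ e y w) ->
  (forall w, al w -> ~~ J w -> exists2 y, J y & e y w) ->
  exists u v, forall A, greedy e al u v A -> A =1 J.
Proof.
move=> m_gt0 e_sym e_irr free Jal Jind Jmax.
pose dom i (w : 'I_m) := J w || [exists y : 'I_m, [&& y < i, J y & e y w]].
(* [mx i]: within [0, i), the part of [J] there dominates every allowed vertex it omits, so it is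
   maximal independent in that segment. *)
pose mx i := [forall w : 'I_m, (w < i) && al w ==> dom i w].
have mxP i (w : 'I_m) : mx i -> w < i -> al w -> ~~ J w ->
    exists y : 'I_m, [/\ y < i, J y & e y w].
  move=> /forallP/(_ w)/implyP + wi alw /negPf nJw.
  rewrite wi alw => /(_ isT); rewrite /dom nJw => /existsP[y /and3P[]].
  by exists y.
have fill u v A : greedy e al u v A -> (forall w : 'I_m, w <= v -> A w = J w) ->
    (forall j, v < j <= m -> mx j) -> A =1 J.
  move=> Agr Av mxj w; have [k] := ubnP (w : nat).
  elim: k w => // k IH w; rewrite ltnS => wk; case: (leqP w v) => [/Av//|vw].
  rewrite Agr vw ltnNge.
  rewrite (ltnW vw) /= -val_eqE /= gtn_eqF //=.
  apply/andP/idP => [[alw /forallP indw]|Jw].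
    apply/negPn/negP => nJw.
    have [|y [yw Jy ey]] := mxP w.+1 w (mxj w.+1 _) (ltnSn _) alw nJw.
      by rewrite ltnS (ltnW vw) /=.
    have {}yw : y < w.
      rewrite ltn_neqAle -ltnS yw andbT; apply: contraL ey => /eqP/val_inj->.
      by rewrite e_irr.
    by have := indw y; rewrite yw (IH y (leq_trans yw wk)) Jy ey.
  split; first exact: Jal.
  apply/forallP => y; apply/implyP => /andP[yw].
  by rewrite (IH y (leq_trans yw wk)) => Jy; exact: Jind.
(* With u = v = 0 nothing lies below v, and maximality on [0, 1) puts vertex 0 into [J] as soon as
   it is allowed. *)
have base : (forall j, j <= m -> mx j) ->
    exists u v, forall A, greedy e al u v A -> A =1 J.
  move=> mxj; exists (Ordinal m_gt0), (Ordinal m_gt0) => A Agr.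
  apply: (fill _ _ _ Agr) => [w|j /andP[_ /mxj//]].
  rewrite leqn0 => /eqP w0; have -> : w = Ordinal m_gt0 by apply: val_inj.
  rewrite Agr eqxx orbT andbT; apply/idP/idP => [al0|/Jal//].
  apply/negPn/negP => nJ.
  have [y [+ Jy]] := mxP 1 (Ordinal m_gt0) (mxj 1 m_gt0) isT al0 nJ.
  rewrite ltnS leqn0 => /eqP y0; have -> : y = Ordinal m_gt0 by apply: val_inj.
  by rewrite e_irr.
suff step i : i <= m -> (forall j, i <= j <= m -> mx j) ->
    exists u v, forall A, greedy e al u v A -> A =1 J.
  apply: (step m) => // j; rewrite -eqn_leq => /eqP<-.
  apply/forallP => w; apply/implyP => /andP[_ alw]; rewrite /dom.
  have [//|nJw] /= := boolP (J w); have [y Jy ey] := Jmax w alw nJw.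
  by apply/existsP; exists y; rewrite ltn_ord Jy.
elim: i => [|i IHi] im mxj; first by apply: base => j jm; apply: mxj.
have [mxi|nmxi] := boolP (mx i).
  apply: IHi => [|j]; first exact: ltnW.
  by rewrite leq_eqVlt => /andP[/predU1P[<-//|ij] jm]; apply: mxj; rewrite ij.
pose v := Ordinal im.
have mxSi : mx i.+1 by apply: mxj; rewrite leqnn.
(* If v were outside [J], maximality on [0, i + 1) would already give it on [0, i). *)
have Jv : J v.
  apply: contraR nmxi => nJv; apply/forallP => w; apply/implyP => /andP[wi alw].
  rewrite /dom; have [//|nJw] /= := boolP (J w).
  have [y [yi Jy ey]] := mxP _ w mxSi (ltnW wi) alw nJw.
  apply/existsP; exists y; rewrite Jy ey !andbT.
  rewrite ltn_neqAle -ltnS yi andbT; apply: contraNneq nJv => yi'.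
  by have -> : v = y by apply: val_inj.
move: nmxi => /forallPn[u]; rewrite negb_imply negb_or => /andP[/andP[ui alu]].
case/andP => nJu /existsPn nu.
have nu' (y : 'I_m) : y < i -> J y -> ~~ e y u.
  by move=> yi Jy; have := nu y; rewrite yi Jy.
have evu : e v u.
  have [y [yi Jy ey]] := mxP _ u mxSi (ltnW ui) alu nJu.
  have [yv|] := eqVneq (y : nat) i; first by have <- : y = v by apply: val_inj.
  by move=> yv; have := nu' y; rewrite ltn_neqAle yv -ltnS yi Jy ey => /(_ isT isT).
exists u, v => A Agr; apply: (fill _ _ _ Agr) => [w|j /mxj//].
rewrite leq_eqVlt => /predU1P[wv|wi].
  have -> : w = v by apply: val_inj.
  by rewrite Agr eqxx orbT andbT Jv Jal.
rewrite Agr wi ltnNge (ltnW wi) -val_eqE /= ltn_eqF //= orbF.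
apply/and3P/idP => [[alw nwu nwv]|Jw]; last first.
  by split; [exact: Jal | exact: nu' | exact: Jind].
apply/negPn/negP => nJw.
have [y [yi Jy ey]] := mxP _ w mxSi (ltnW wi) alw nJw.
have [yv|yv] := eqVneq (y : nat) i.
  have yv' : y = v by apply: val_inj.
  by rewrite e_sym -yv' ey in nwv.
have {}yi : y < i by rewrite ltn_neqAle yv -ltnS.
have := free v u y w (Jal _ Jv) alu (Jal _ Jy) alw evu ey.
rewrite (negPf (Jind _ _ Jv Jy)) (e_sym v w) (negPf nwv).
by rewrite (e_sym u y) (negPf (nu' _ yi Jy)) (e_sym u w) (negPf nwu).
Qed.

(** * The program and its specification *)

(** Truncated subtraction is the only test available: [1 - e] tests for zero, and every predicate
    below is brought to 0 or 1 by negations. *)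
Definition ENot e := ESub (Const 1) e.
Definition EAnd e1 e2 := ENot (Add (ENot e1) (ENot e2)).
Definition EOr e1 e2 := ENot (ENot (Add e1 e2)).
Definition ELt e1 e2 := ENot (ENot (ESub e2 e1)).
Definition ELe e1 e2 := ENot (ESub e1 e2).
Definition EEq e1 e2 := ENot (Add (ESub e1 e2) (ESub e2 e1)).
Definition EMin e1 e2 := ESub e1 (ESub e1 e2).

Lemma evalConst s k : eval s (Const k) = k. Proof. by []. Qed.
Lemma evalVar s x : eval s (Var x) = var s x. Proof. by []. Qed.
Lemma evalRead s a e : eval s (Read a e) = arr s a (eval s e).
Proof. by []. Qed.
Lemma evalAdd s e1 e2 : eval s (Add e1 e2) = eval s e1 + eval s e2.
Proof. by []. Qed.
Lemma evalSub s e1 e2 : eval s (ESub e1 e2) = eval s e1 - eval s e2.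
Proof. by []. Qed.

Lemma evalNot s e : eval s (ENot e) = (eval s e == 0).
Proof. by rewrite /ENot evalSub evalConst; case: (eval s e) => [|[]]. Qed.

Lemma evalAnd s e1 e2 :
  eval s (EAnd e1 e2) = (eval s e1 != 0) && (eval s e2 != 0).
Proof.
rewrite /EAnd !(evalNot, evalAdd).
by case: (eval s e1) (eval s e2) => [|a] [].
Qed.

Lemma evalOr s e1 e2 :
  eval s (EOr e1 e2) = (eval s e1 != 0) || (eval s e2 != 0).
Proof.
rewrite /EOr !(evalNot, evalAdd).
by case: (eval s e1) (eval s e2) => [|a] [].
Qed.

Lemma evalLt s e1 e2 : eval s (ELt e1 e2) = (eval s e1 < eval s e2).
Proof. by rewrite /ELt !(evalNot, evalSub) subn_eq0 ltnNge; case: leqP. Qed.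

Lemma evalLe s e1 e2 : eval s (ELe e1 e2) = (eval s e1 <= eval s e2).
Proof. by rewrite /ELe evalNot evalSub subn_eq0. Qed.

Lemma evalEq s e1 e2 : eval s (EEq e1 e2) = (eval s e1 == eval s e2).
Proof. by rewrite /EEq evalNot evalAdd !evalSub addn_eq0 !subn_eq0 -eqn_leq. Qed.

Lemma evalMin s e1 e2 : eval s (EMin e1 e2) = minn (eval s e1) (eval s e2).
Proof. by rewrite /EMin !evalSub; lia. Qed.

Opaque ENot EAnd EOr ELt ELe EEq EMin.

Lemma bit_neq0 (b : bool) : (b != 0 :> nat) = b. Proof. by case: b. Qed.
Lemma bit_eq0 (b : bool) : (b == 0 :> nat) = ~~ b. Proof. by case: b. Qed.

Definition evalE := (evalAnd, evalOr, evalLt, evalLe, evalEq, evalMin, evalNot,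
  evalConst, evalVar, evalRead, evalAdd, evalSub, bit_neq0, bit_eq0).

(* Variables 0 to 5 hold the input.
   6: 2 ^ #|X|; 7: number of the guessed subset of X; 8, 9: the pair (u, v);
   10, 11, 16: loop counters; 12, 13: scratch; 14: conflicts; 15: result;
   17: size of the cover.
   Arrays 0 to 2 hold the input.
   3: starts of the rows of array 2; 4: place values of the elements of X;
   5: guessed part Z of X; 6: greedy independent set; 7: complement of the
   cover; 8: distances. *)

Definition EAdj i j := Read 2 (Add (Read 3 i) j).
Definition adjn (s : state) (i j : nat) := arr s 2 (arr s 3 i + j) != 0.
Lemma evalAdj s i j : (eval s (EAdj i j) != 0) = adjn s (eval s i) (eval s j).
Proof. by []. Qed.
Opaque EAdj.

Definition count_prog c x e :=
  PSeq (PAssign c (Const 0)) (PFor x 3 (PAssign c (Add (Var c) e))).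

Lemma den_count c x e (f : nat -> nat) s : uniq [:: c; x; 3] ->
  (forall z, var z x < var s 3 ->
     (forall y, y \notin [:: x; c] -> var z y = var s y) ->
     (forall a j, arr z a j = arr s a j) -> eval z e = f (var z x)) ->
  var (den (count_prog c x e) s) c = \sum_(i < var s 3) f i.
Proof.
rewrite /= !inE negb_or andbT => /andP[/andP[cx c3] x3] He.
rewrite denE denAssign; set s0 := set_var c _ s.
have s03 : var s0 3 = var s 3 by rewrite /= eq_sym (negPf c3).
rewrite -s03.
apply: (@den_for (fun i z => var z c = \sum_(j < i) f j)).
- by rewrite inE eq_sym.
- by move=> i k z /=; rewrite (negPf cx).
- by rewrite big_ord0 /= eqxx.
move=> i z lt_i zx zv za zc.
rewrite denE /= eqxx evalAdd evalVar zc big_ord_recr /= -zx He ?zx -?s03 //.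
  move=> y; rewrite !inE negb_or => /andP[yx yc].
  by rewrite zv ?inE ?negb_or ?yx //= (negPf yc).
by move=> a j; rewrite za.
Qed.

Definition greedy_prog :=
  PFor 10 3 (PSeq
    (count_prog 12 11 (EAnd (ELt (Var 11) (Var 10))
                   (EAnd (Read 6 (Var 11)) (EAdj (Var 11) (Var 10)))))
    (PStore 6 (Var 10) (EAnd (ENot (Read 1 (Var 10)))
      (EOr (EAnd (ELt (Var 10) (Var 9))
                 (EAnd (ENot (EAdj (Var 10) (Var 8)))
                       (ENot (EAdj (Var 10) (Var 9)))))
        (EOr (EEq (Var 10) (Var 9))
             (EAnd (ELt (Var 9) (Var 10)) (ENot (Var 12)))))))).

(** The memory version of [greedy]: the quantifier over earlier vertices becomes a count that must
    vanish. *)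
Definition greedy_cell s (A : nat -> nat) w :=
  (arr s 1 w == 0) &&
  [|| [&& w < var s 9, ~~ adjn s w (var s 8) & ~~ adjn s w (var s 9)],
      w == var s 9
    | (var s 9 < w) &&
      (\sum_(y < var s 3) [&& y < w, A y != 0 & adjn s y w] == 0)].

Lemma greedy_cell_ext s A A' w :
  (forall y, y < w -> A y = A' y) -> greedy_cell s A w = greedy_cell s A' w.
Proof.
move=> AA'; congr (_ && [|| _, _ | _ && (_ == _)]).
by apply: eq_bigr => y _; case: ltnP => //= /AA'->.
Qed.

Lemma evalNotAdj s i j :
  (eval s (EAdj i j) == 0) = ~~ adjn s (eval s i) (eval s j).
Proof. by rewrite -evalAdj negbK. Qed.

Lemma den_greedy s w : w < var s 3 ->
  (arr (den greedy_prog s) 6 w != 0) =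
  greedy_cell s (arr (den greedy_prog s) 6) w.
Proof.
move: w; apply: (@den_for (fun i z => forall w, w < i ->
  (arr z 6 w != 0) = greedy_cell s (arr z 6) w)) => //.
move=> i z lt_i zi zv za IH; rewrite denSeq; set z1 := den _ z.
have z1v y : y \notin [:: 10; 12; 11] -> var z1 y = var s y.
  by move=> Hy; rewrite den_var ?zv //; apply: contra Hy; rewrite /= !inE;
    case: (y == 10) (y == 11) (y == 12) => [] [] [].
have z1a a j : arr z1 a j = arr z a j by rewrite den_arr.
have z1i : var z1 10 = i by rewrite den_var.
have z1c : var z1 12 =
    \sum_(y < var s 3) [&& y < i, arr z 6 y != 0 & adjn s y i].
  rewrite -[var s 3](zv 3) //; apply: (@den_count _ _ _
      (fun y => nat_of_bool [&& y < i, arr z 6 y != 0 & adjn s y i])) =>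
      // y lt_y yv ya.
  by rewrite !(evalE, evalAdj) (yv 10) // zi /adjn !ya !(za 2) // !(za 3).
rewrite denE evalVar z1i; set b := eval _ _.
have Ab y : y < i -> arr (set_arr 6 i b z1) 6 y = arr z 6 y.
  by move=> yi; rewrite /= z1a ltn_eqF.
move=> w; rewrite ltnS leq_eqVlt => /predU1P[->|wi]; last first.
  rewrite Ab // IH //; apply: greedy_cell_ext => y yw.
  by rewrite Ab // (ltn_trans yw).
rewrite (greedy_cell_ext s Ab) /= eqxx /b !(evalE, evalAdj, evalNotAdj).
rewrite z1c (z1v 9) // (z1v 8) // z1i /adjn !z1a (za 1) // !(za 2) // !(za 3) //.
Qed.

Definition free_prog :=
  PFor 10 3 (PSeq
    (count_prog 12 11 (EAnd (Read 5 (Var 11)) (EAdj (Var 11) (Var 10))))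
    (PStore 7 (Var 10)
       (EOr (Read 5 (Var 10)) (EAnd (Read 6 (Var 10)) (ENot (Var 12)))))).

Lemma den_free s w : w < var s 3 ->
  (arr (den free_prog s) 7 w != 0) =
  (arr s 5 w != 0) || (arr s 6 w != 0) &&
    (\sum_(y < var s 3) ((arr s 5 y != 0) && adjn s y w) == 0).
Proof.
move: w; apply: (@den_for (fun i z => forall w, w < i ->
  (arr z 7 w != 0) = (arr s 5 w != 0) || (arr s 6 w != 0) &&
    (\sum_(y < var s 3) ((arr s 5 y != 0) && adjn s y w) == 0))) => //.
move=> i z lt_i zi zv za IH; rewrite denSeq; set z1 := den _ z.
have z1a a j : arr z1 a j = arr z a j by rewrite den_arr.
have z1i : var z1 10 = i by rewrite den_var.
have z1c : var z1 12 = \sum_(y < var s 3) ((arr s 5 y != 0) && adjn s y i).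
  rewrite -[var s 3](zv 3) //; apply: (@den_count _ _ _
    (fun y => nat_of_bool ((arr s 5 y != 0) && adjn s y i))) => // y lt_y yv ya.
  by rewrite !(evalE, evalAdj) (yv 10) // zi /adjn !ya !(za 2) // !(za 3) // za.
move=> w; rewrite ltnS leq_eqVlt denE evalVar z1i => /predU1P[->|wi] /=.
  by rewrite eqxx !evalE z1i z1c !z1a !za.
by rewrite (ltn_eqF wi) z1a IH.
Qed.

Definition cover_prog := count_prog 17 10 (ENot (Read 7 (Var 10))).

Lemma den_cover s :
  var (den cover_prog s) 17 = \sum_(i < var s 3) (arr s 7 i == 0).
Proof.
apply: (@den_count _ _ _ (fun i => nat_of_bool (arr s 7 i == 0))) => // z _ _ za.
by rewrite !evalE za.
Qed.

(** Counts adjacencies among the edges left out of F: the count is zero exactly when F is a vertex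
    cover. *)
Definition conflict_prog :=
  PSeq (PAssign 14 (Const 0)) (PFor 10 3 (PSeq
    (count_prog 12 11 (EAnd (Read 7 (Var 10))
                   (EAnd (Read 7 (Var 11)) (EAdj (Var 10) (Var 11)))))
    (PAssign 14 (Add (Var 14) (Var 12))))).

Lemma den_conflict s :
  var (den conflict_prog s) 14 =
  \sum_(i < var s 3) \sum_(j < var s 3)
    [&& arr s 7 i != 0, arr s 7 j != 0 & adjn s i j].
Proof.
rewrite denE denAssign; set s0 := set_var 14 _ s.
apply: (@den_for (fun k z => var z 14 = \sum_(i < k) \sum_(j < var s 3)
    [&& arr s 7 i != 0, arr s 7 j != 0 & adjn s i j])) => //.
  by rewrite big_ord0.
move=> i z lt_i zi zv za IH; rewrite !denE /= !evalE big_ord_recr /= -IH.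
rewrite den_var //; congr (_ + _).
rewrite -[var s 3](zv 3) //; apply: (@den_count _ _ _
  (fun j => nat_of_bool [&& arr s 7 i != 0, arr s 7 j != 0 & adjn s i j])) => //.
move=> y lt_y yv ya.
by rewrite !(evalE, evalAdj) (yv 10) // zi /adjn !ya !za.
Qed.

(** * Shortest paths with edge lengths 0 and 1 *)

Definition relax_prog :=
  let e2 := Add (Var 11) (Var 11) in
  let a := Read 0 e2 in
  let b := Read 0 (Add e2 (Const 1)) in
  let w := ENot (ENot (Read 7 (Var 11))) in
  PSeq (PStore 8 b (EMin (Read 8 b) (Add (Read 8 a) w)))
       (PStore 8 a (EMin (Read 8 a) (Add (Read 8 b) w))).

(** Bellman-Ford: it fits bounded loops, and n rounds suffice because a simple path has fewer than n
    edges. *)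
Definition bellman_prog := PFor 16 0 (PFor 11 3 relax_prog).

Definition end1 s e := arr s 0 (e + e).
Definition end2 s e := arr s 0 (e + e + 1).
Definition weight s e : nat := arr s 7 e != 0.

Definition upd (D : nat -> nat) x v y := if y == x then v else D y.

Definition relax (a b w : nat) D :=
  let D1 := upd D b (minn (D b) (D a + w)) in
  upd D1 a (minn (D1 a) (D1 b + w)).

Lemma den_relax s x :
  arr (den relax_prog s) 8 x =
  relax (end1 s (var s 11)) (end2 s (var s 11)) (weight s (var s 11)) (arr s 8) x.
Proof. by rewrite !denE /= !evalE. Qed.

Lemma relax_le a b w D x : relax a b w D x <= D x.
Proof.
rewrite /relax; set D1 := upd D _ _.
have leD y : D1 y <= D y by rewrite /D1 /upd; case: eqP => // ->; rewrite geq_minl.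
rewrite {1}/upd; case: eqP => // ->.
exact: leq_trans (geq_minl _ _) (leD _).
Qed.

Lemma relax_end2 a b w D : relax a b w D b <= D a + w.
Proof.
rewrite /relax; set D1 := upd D _ _.
apply: (@leq_trans (D1 b)); last by rewrite /D1 /upd eqxx geq_minr.
by rewrite {1}/upd; case: eqP => // ->; rewrite geq_minl.
Qed.

Lemma relax_end1 a b w D : relax a b w D a <= D b + w.
Proof.
rewrite /relax; set D1 := upd D _ _.
rewrite {1}/upd eqxx; apply: leq_trans (geq_minr _ _) _.
by rewrite leq_add2r /D1 /upd eqxx geq_minl.
Qed.

(** Nothing is claimed about values above [k], so such a value can stand for infinity: if a sum is
    at most [k], so is the distance it extends. *)
Lemma relax_sound (R : nat -> nat -> Prop) k a b w D :
  (forall d, R a d -> R b (d + w)) -> (forall d, R b d -> R a (d + w)) ->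
  (forall x, D x <= k -> R x (D x)) ->
  forall x, relax a b w D x <= k -> R x (relax a b w D x).
Proof.
move=> Rab Rba RD; rewrite /relax; set D1 := upd D _ _.
have RD1 x : D1 x <= k -> R x (D1 x).
  rewrite /D1 /upd; case: eqP => [->|_]; last exact: RD.
  rewrite /minn; case: ifP => _ le_k; first exact: RD.
  exact/Rab/RD/(leq_trans (leq_addr _ _) le_k).
move=> x; rewrite {1 2}/upd; case: eqP => [->|_]; last exact: RD1.
rewrite /minn; case: ifP => _ le_k; first exact: RD1.
exact/Rba/RD1/(leq_trans (leq_addr _ _) le_k).
Qed.

(** Walks from the source, with number of edges and length. There are two step rules because edges
    are undirected but their endpoints are stored in an order. *)
Inductive walk (s : state) : nat -> nat -> nat -> Prop :=
  | walk0 : walk s 0 (var s 1) 0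
  | walk_fwd k e d : e < var s 3 -> walk s k (end1 s e) d ->
      walk s k.+1 (end2 s e) (d + weight s e)
  | walk_bwd k e d : e < var s 3 -> walk s k (end2 s e) d ->
      walk s k.+1 (end1 s e) (d + weight s e).

Lemma den_bellman_sound (R : nat -> nat -> Prop) s :
  (forall e d, e < var s 3 -> R (end1 s e) d -> R (end2 s e) (d + weight s e)) ->
  (forall e d, e < var s 3 -> R (end2 s e) d -> R (end1 s e) (d + weight s e)) ->
  (forall x, arr s 8 x <= var s 3 -> R x (arr s 8 x)) ->
  forall x, arr (den bellman_prog s) 8 x <= var s 3 ->
    R x (arr (den bellman_prog s) 8 x).
Proof.
move=> R12 R21 Rs; pose ok z := forall x, arr z 8 x <= var s 3 -> R x (arr z 8 x).
apply: (@den_for (fun _ => ok)) => // i z lt_i _ zv za okz.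
apply: (@den_for (fun _ => ok)) => // j y lt_j yj yv ya oky x.
have e1 : end1 y j = end1 s j by rewrite /end1 ya // za.
have e2 : end2 y j = end2 s j by rewrite /end2 ya // za.
have ew : weight y j = weight s j by rewrite /weight ya // za.
rewrite zv // in lt_j; rewrite den_relax yj e1 e2 ew.
by move: x; apply: relax_sound => // d; [apply: R12 | apply: R21].
Qed.

Lemma den_bellman_complete s k x d : arr s 8 (var s 1) = 0 ->
  walk s k x d -> k <= var s 0 -> arr (den bellman_prog s) 8 x <= d.
Proof.
move=> s0; move: k x d.
apply: (@den_for (fun i z => forall k x d, walk s k x d -> k <= i ->
   arr z 8 x <= d)) => //.
  by move=> k x d; case=> //; rewrite s0.
move=> i z lt_i _ zv za IH.
(* Within a round, values are compared with those at its start; later relaxations only lower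
   them. *)
pose Q j y := (forall x, arr y 8 x <= arr z 8 x) /\
  (forall e, e < j -> arr y 8 (end2 s e) <= arr z 8 (end1 s e) + weight s e /\
    arr y 8 (end1 s e) <= arr z 8 (end2 s e) + weight s e).
have [Q1 Q2] : Q (var z 3) (den (PFor 11 3 relax_prog) z).
  apply: (@den_for Q) => // j y lt_j yj yv ya [le_yz IHj].
  have e1 : end1 y j = end1 s j by rewrite /end1 ya // za.
  have e2 : end2 y j = end2 s j by rewrite /end2 ya // za.
  have ew : weight y j = weight s j by rewrite /weight ya // za.
  have le_y x : arr (den relax_prog y) 8 x <= arr y 8 x.
    by rewrite den_relax relax_le.
  split=> [x|e]; first exact: leq_trans (le_y x) (le_yz x).
  rewrite ltnS leq_eqVlt => /predU1P[->|/IHj[H1 H2]]; last first.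
    by split; [apply: leq_trans H1 | apply: leq_trans H2].
  rewrite !den_relax yj e1 e2 ew; split.
    by apply: leq_trans (relax_end2 _ _ _ _) _; rewrite leq_add2r.
  by apply: leq_trans (relax_end1 _ _ _ _) _; rewrite leq_add2r.
rewrite zv // in Q2 => k x d.
case: k x d / => [|k e d lt_e W|k e d lt_e W] ki.
- by apply: leq_trans (Q1 _) (IH _ _ _ (walk0 s) _).
- have [H _] := Q2 e lt_e; apply: leq_trans H _.
  by rewrite leq_add2r (IH _ _ _ W).
- have [_ H] := Q2 e lt_e; apply: leq_trans H _.
  by rewrite leq_add2r (IH _ _ _ W).
Qed.

(** The value m + 1 encodes infinity: a simple path has length at most m. *)
Definition dist_init_prog :=
  PSeq (PFor 10 0 (PStore 8 (Var 10) (Add (Var 3) (Const 1))))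
       (PStore 8 (Var 1) (Const 0)).

Lemma den_dist_init s x : x < var s 0 ->
  arr (den dist_init_prog s) 8 x = if x == var s 1 then 0 else var s 3 + 1.
Proof.
rewrite !denE /= evalE den_var //; case: eqP => // _; rewrite ?evalE //.
move: x; apply: (@den_for (fun i z => forall x, x < i ->
  arr z 8 x = var s 3 + 1)) => // i z lt_i zi zv za IH x.
rewrite ltnS leq_eqVlt denE /= evalE zi => /predU1P[->|xi].
  by rewrite eqxx !evalE zv.
by rewrite (ltn_eqF xi) IH.
Qed.

(* Guesses are numbered in binary, with one binary place for each element of X. *)
Fixpoint place (X : pred nat) i :=
  if i is i'.+1 then if X i' then place X i' + place X i' else place X i'
  else 1.

Lemma place_pow X i : place X i = 2 ^ \sum_(j < i) X j.
Proof.
elim: i => [|i IHi] /=; first by rewrite big_ord0.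
rewrite big_ord_recr /= IHi; case: (X i); last by rewrite addn0.
by rewrite addn1 expnS mul2n addnn.
Qed.

(** Place values are superincreasing, which makes decoding from the top place by comparison and
    subtraction correct. *)
Lemma place_gt (X S : pred nat) i : (forall j, S j -> X j) ->
  \sum_(j < i | S j) place X j < place X i.
Proof.
move=> SX; elim: i => [|i IHi]; first by rewrite big_ord0.
rewrite big_mkcond big_ord_recr /= -big_mkcond /=.
case: (boolP (S i)) => [/SX->|_]; first by rewrite ltn_add2r.
by rewrite addn0 (leq_trans IHi) //; case: (X i) => //; rewrite leq_addr.
Qed.

Definition place_prog :=
  PSeq (PAssign 6 (Const 1)) (PFor 10 3
    (PSeq (PStore 4 (Var 10) (Var 6))
      (PIf (Read 1 (Var 10)) (PAssign 6 (Add (Var 6) (Var 6)))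
                             (PAssign 6 (Var 6))))).

Definition inX (s : state) : pred nat := fun i => arr s 1 i != 0.
Arguments inX : simpl never.

Lemma den_place s (s' := den place_prog s) :
  var s' 6 = place (inX s) (var s 3) /\
  forall i, i < var s 3 -> arr s' 4 i = place (inX s) i.
Proof.
rewrite {}/s' denE denAssign; set s0 := set_var 6 _ s.
apply: (@den_for (fun i z => var z 6 = place (inX s) i /\
   forall j, j < i -> arr z 4 j = place (inX s) j)) => //.
move=> i z lt_i zi zv za [z6 z4].
have xi : (arr z 1 i != 0) = inX s i by rewrite za.
rewrite !denE !evalE zi /= zi xi -z6.
split=> [|j]; first by case: (inX s i).
have -> (b : bool) y1 y2 y :
    arr (if b then set_var 6 y1 y else set_var 6 y2 y) 4 j = arr y 4 j by case: b.
rewrite ltnS leq_eqVlt /= => /predU1P[->|ji]; first by rewrite eqxx.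
by rewrite (ltn_eqF ji) z4.
Qed.

Definition decode_prog :=
  let j := ESub (ESub (Var 3) (Const 1)) (Var 10) in
  PSeq (PAssign 13 (Var 7)) (PFor 10 3
    (PIf (EAnd (Read 1 j) (ELe (Read 4 j) (Var 13)))
      (PSeq (PStore 5 j (Const 1)) (PAssign 13 (ESub (Var 13) (Read 4 j))))
      (PStore 5 j (Const 0)))).

Lemma den_decode (S : pred nat) s : (forall j, S j -> inX s j) ->
  (forall i, i < var s 3 -> arr s 4 i = place (inX s) i) ->
  var s 7 = \sum_(j < var s 3 | S j) place (inX s) j ->
  forall j, j < var s 3 -> (arr (den decode_prog s) 5 j != 0) = S j.
Proof.
move=> SX s4 s7; rewrite denE denAssign; set s0 := set_var 13 _ s.
pose Q i z := i <= var s 3 ->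
  var z 13 = \sum_(j < var s 3 - i | S j) place (inX s) j /\
  forall j, var s 3 - i <= j < var s 3 -> (arr z 5 j != 0) = S j.
set p := PFor _ _ _; suff : Q (var s0 3) (den p s0).
  by case=> // _ Hj j lt_j; apply: Hj; rewrite /= subnn.
apply: (@den_for Q) => //.
  by move=> _; split=> [|j]; [rewrite subn0 -s7 | lia].
move=> i z lt_i zi zv za IH _; have [r_eq Zeq] := IH (ltnW lt_i).
rewrite /= in lt_i; set j0 := var s 3 - 1 - i.
have j0S : var s 3 - i = j0.+1 by rewrite /j0; lia.
have j0S' : var s 3 - i.+1 = j0 by rewrite /j0; lia.
have j0lt : j0 < var s 3 by rewrite /j0; lia.
have gt := place_gt j0 SX.
rewrite j0S big_mkcond big_ord_recr /= -big_mkcond /= in r_eq.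
(* The remainder reaches the place value of [j0] exactly when [j0] is in [S], since the lower places
   sum to less. *)
have condE : inX s j0 && (place (inX s) j0 <= var z 13) = S j0.
  rewrite r_eq; case: (boolP (S j0)) => [/SX->|_]; first by rewrite leq_addl.
  by rewrite addn0 leqNgt gt andbF.
have z3 : var z 3 = var s 3 by rewrite zv.
have zX : (arr z 1 j0 != 0) = inX s j0 by rewrite za.
have z4 : arr z 4 j0 = place (inX s) j0 by rewrite za // -s4.
rewrite j0S' !denE !evalE zi z3 -/j0 z4 zX condE.
have Zj j : j0 < j < var s 3 -> (arr z 5 j != 0) = S j.
  by move=> Hj; apply: Zeq; rewrite j0S.
case: (boolP (S j0)) => Sj0 /=; rewrite ?zi ?z3 -?/j0 ?z4; split.
- by rewrite r_eq Sj0 addnK.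
- move=> j; rewrite leq_eqVlt; case: eqVneq => [<- _|]; first by rewrite Sj0.
  by move=> _ /Zj.
- by rewrite r_eq (negPf Sj0) addn0.
- move=> j; rewrite leq_eqVlt; case: eqVneq => [<- _|]; first by rewrite (negPf Sj0).
  by move=> _ /Zj.
Qed.

(** Without multiplication, the row offsets are accumulated by addition. *)
Definition row_prog :=
  PSeq (PAssign 13 (Const 0)) (PFor 10 3
    (PSeq (PStore 3 (Var 10) (Var 13)) (PAssign 13 (Add (Var 13) (Var 3))))).

Lemma den_row s i : i < var s 3 -> arr (den row_prog s) 3 i = i * var s 3.
Proof.
rewrite denE denAssign; set s0 := set_var 13 _ s; move: i.
suff [] : var (den (PFor 10 3 (PSeq (PStore 3 (Var 10) (Var 13))
    (PAssign 13 (Add (Var 13) (Var 3))))) s0) 13 = var s0 3 * var s 3 /\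
  forall i, i < var s0 3 -> arr (den (PFor 10 3 (PSeq (PStore 3 (Var 10) (Var 13))
    (PAssign 13 (Add (Var 13) (Var 3))))) s0) 3 i = i * var s 3 by [].
apply: (@den_for (fun k z => var z 13 = k * var s 3 /\
  forall i, i < k -> arr z 3 i = i * var s 3)) => //.
move=> i z lt_i zi zv za [z13 z3]; rewrite !denE !evalE zi /= z13 (zv 3) //.
split=> [|j]; first by rewrite mulSn addnC.
rewrite ltnS leq_eqVlt => /predU1P[->|ji]; first by rewrite eqxx.
by rewrite (ltn_eqF ji) z3.
Qed.

(** * One round of the search *)

(** Variable 15 counts successful rounds and is never reset, so success persists. The bound m on the
    distance excludes an unreachable target. *)
Definition test_prog :=
  PAssign 15 (Add (Var 15) (EAnd (ENot (Var 14)) (EAnd (ENot (Var 4))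
    (EAnd (ELe (Read 8 (Var 2)) (Var 3))
          (ELe (Add (Var 17) (Read 8 (Var 2))) (Var 5)))))).

Definition body_prog :=
  PSeq decode_prog (PSeq greedy_prog (PSeq free_prog (PSeq cover_prog
    (PSeq conflict_prog (PSeq dist_init_prog (PSeq bellman_prog test_prog)))))).

Definition search_prog := PFor 7 6 (PFor 8 3 (PFor 9 3 body_prog)).

(** Hides the programs from the correctness proofs; [z] is the state just before the distance
    computation. The decoding clause is conditional, so that soundness can ignore which subset was
    guessed. *)
Lemma den_body s : exists z,
  [/\ [/\ var z 0 = var s 0, var z 1 = var s 1, var z 3 = var s 3,
          forall i, arr z 0 i = arr s 0 i
        & forall S : pred nat, (forall j, S j -> inX s j) ->
            (forall i, i < var s 3 -> arr s 4 i = place (inX s) i) ->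
            var s 7 = \sum_(j < var s 3 | S j) place (inX s) j ->
            forall j, j < var s 3 -> (arr z 5 j != 0) = S j],
      forall w, w < var s 3 -> (arr z 6 w != 0) = greedy_cell s (arr z 6) w,
      forall w, w < var s 3 -> (arr z 7 w != 0) =
        (arr z 5 w != 0) || (arr z 6 w != 0) &&
          (\sum_(y < var s 3) ((arr z 5 y != 0) && adjn s y w) == 0),
      forall x, x < var s 0 ->
        arr z 8 x = if x == var s 1 then 0 else var s 3 + 1
    & var (den body_prog s) 15 = var s 15 +
        [&& \sum_(i < var s 3) \sum_(j < var s 3)
              [&& arr z 7 i != 0, arr z 7 j != 0 & adjn s i j] == 0,
            var s 4 == 0,
            arr (den bellman_prog z) 8 (var s 2) <= var s 3
          & \sum_(i < var s 3) (arr z 7 i == 0)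
              + arr (den bellman_prog z) 8 (var s 2) <= var s 5]].
Proof.
pose s1 := den decode_prog s; pose s2 := den greedy_prog s1.
pose s3 := den free_prog s2; pose s4 := den cover_prog s3.
pose s5 := den conflict_prog s4; pose z := den dist_init_prog s5.
have e3 x : x = 3 \/ x = 8 \/ x = 9 -> var s1 x = var s x.
  by case=> [->|[]->]; rewrite den_var.
have z5 i : arr z 5 i = arr s1 5 i by do 5!rewrite den_arr //.
have z6 i : arr z 6 i = arr s2 6 i by do 4!rewrite den_arr //.
have z7 i : arr z 7 i = arr s3 7 i by do 3!rewrite den_arr //.
have adj1 i j : adjn s1 i j = adjn s i j by rewrite /adjn !den_arr.
have adj2 i j : adjn s2 i j = adjn s i j by rewrite /adjn !den_arr.
have adj4 i j : adjn s4 i j = adjn s i j by rewrite /adjn !den_arr.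
have m2 : var s2 3 = var s 3 by rewrite !den_var.
have m3 : var s3 3 = var s 3 by rewrite !den_var.
have m4 : var s4 3 = var s 3 by rewrite !den_var.
exists z; split.
- split=> [||||S SX s4P s7 j lt_j]; try by rewrite !den_var.
    by move=> i; rewrite !den_arr.
  by rewrite z5; apply: den_decode.
- move=> w lt_w; rewrite z6 den_greedy; last by rewrite e3 //; left.
  rewrite -/s2 (@greedy_cell_ext _ _ (arr z 6)) => [|y _]; last by rewrite z6.
  rewrite /greedy_cell !e3; try tauto.
  rewrite !adj1 den_arr //; congr (_ && [|| _, _ | _ && (_ == _)]).
  by apply: eq_bigr => y _; rewrite adj1.
- move=> w lt_w; rewrite z7 den_free ?m2 // z5 z6 den_arr //.
  congr (_ || _ && (_ == _)); apply: eq_bigr => y _.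
  by rewrite adj2 z5 den_arr.
- move=> x lt_x; have v5 i : i < 4 -> var s5 i = var s i.
    by case: i => [|[|[|[|]]]] // _; rewrite !den_var.
  by rewrite /z den_dist_init ?v5.
have b14 : var (den bellman_prog z) 14 = \sum_(i < var s 3) \sum_(j < var s 3)
    [&& arr z 7 i != 0, arr z 7 j != 0 & adjn s i j].
  do 2!rewrite den_var //; rewrite den_conflict m4.
  apply: eq_bigr => i _; apply: eq_bigr => j _.
  by rewrite adj4 !z7 !(@den_arr cover_prog).
have b17 : var (den bellman_prog z) 17 = \sum_(i < var s 3) (arr z 7 i == 0).
  do 3!rewrite den_var //; rewrite den_cover m3.
  by apply: eq_bigr => i _; rewrite z7.
have vb x : x \in [:: 2; 3; 4; 5; 15] -> var (den bellman_prog z) x = var s x.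
  by rewrite !inE => /or4P[|||/orP[]] /eqP->; do !rewrite den_var //.
rewrite /body_prog 7!denSeq -[den dist_init_prog _]/z denAssign.
by rewrite var_set !evalE b14 b17 !vb.
Qed.

(** * Correctness on instances *)

Lemma nth_allpairs (S T R : Type) (f : S -> T -> R) x0 y0 z0 s t i j :
  i < size s -> j < size t ->
  nth z0 [seq f x y | x <- s, y <- t] (i * size t + j) =
  f (nth x0 s i) (nth y0 t j).
Proof.
elim: s i => // x s IHs [|i] lt_i lt_j; rewrite /= nth_cat size_map.
  by rewrite lt_j (nth_map y0).
by rewrite mulSn -addnA ltnNge leq_addr /= addKn IHs.
Qed.

Lemma nth_flatten_pairs (T : Type) (x0 : T) (ss : seq (seq T)) i b :
  all (fun s => size s == 2) ss -> b < 2 -> i < size ss ->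
  nth x0 (flatten ss) (i + i + b) = nth x0 (nth [::] ss i) b.
Proof.
move=> + b2; elim: ss i => // s ss IH i /= /andP[/eqP s2 /IH{}IH].
case: i => [|i] lt_i; rewrite nth_cat s2 ?b2 //.
by rewrite addnS !addSn !subSS subn0 /= IH.
Qed.

Notation nedges I := #|edge (graph I)|.
Notation nth_edge I i := (@enum_val (edge (graph I)) (edge (graph I)) i).

Lemma inX_input (I : instance) (i : 'I_(nedges I)) :
  inX (input I) i = (nth_edge I i \in modulator I).
Proof.
rewrite /inX /= (nth_map (nth_edge I i)) -?cardE ?ltn_ord //.
by rewrite -enum_val_nth bit_neq0.
Qed.

Lemma adj_input (I : instance) (i j : 'I_(nedges I)) :
  (arr (input I) 2 (i * nedges I + j) != 0) =
  forcing I (nth_edge I i) (nth_edge I j).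
Proof.
set es := enum (edge (graph I)).
have m_es : #|edge (graph I)| = size es by rewrite cardE.
rewrite /= -/es; set k := nat_of_ord i; set l := nat_of_ord j.
have [lt_k lt_l] : k < size es /\ l < size es by rewrite -m_es !ltn_ord.
rewrite m_es (nth_allpairs _ (nth_edge I i) (nth_edge I i)) //.
by rewrite -!enum_val_nth bit_neq0.
Qed.

Lemma edge_ends (V : finType) (G : sgraph V) (e : edge G) :
  exists a b, enum (ends e) = [:: a; b] /\ ends e = [set a; b].
Proof.
have := valP e; rewrite [val e]/(ends e) => /imsetP[[a b]].
rewrite inE /= => Gab E.
have ab : a != b by apply: contraTneq Gab => ->; rewrite adj_irr.
have : size (enum (ends e)) = 2 by rewrite -cardE /ends E cards2 ab.
case def_s: (enum _) => [|x [|y []]] // _; exists x, y; split=> //.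
by apply/setP => v; rewrite -mem_enum def_s !inE.
Qed.

Lemma ends_input (I : instance) (i : 'I_(nedges I)) :
  exists a b : 'I_(nverts I), [/\ end1 (input I) i = a, end2 (input I) i = b
    & ends (nth_edge I i) = [set a; b]].
Proof.
have [a [b [Eab ends_ab]]] := edge_ends (nth_edge I i).
have H c : c < 2 ->
    arr (input I) 0 (i + i + c) = nth 0 [:: nat_of_ord a; nat_of_ord b] c.
  move=> c2; rewrite /= nth_flatten_pairs //.
  - rewrite (nth_map (nth_edge I i)) -?cardE ?ltn_ord //.
    by rewrite -enum_val_nth Eab.
  - apply/allP => _ /mapP[e _ ->]; rewrite size_map.
    by have [x [y [-> _]]] := edge_ends e.
  - by rewrite size_map -cardE.
exists a, b; split=> //; last exact: (H 1).
by rewrite /end1 -[i + i]addn0 H.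
Qed.

Lemma place_ext (X Y : pred nat) i :
  (forall j, j < i -> X j = Y j) -> place X i = place Y i.
Proof.
move=> XY; rewrite !place_pow; congr (2 ^ _).
by apply: eq_bigr => j _; rewrite XY.
Qed.

Lemma sum_nth_edge I (F : pred (edge (graph I))) :
  \sum_(i < nedges I) F (nth_edge I i) = #|[set e | F e]|.
Proof.
rewrite -(@big_enum_val nat 0 addn _ (edge (graph I)) (fun e => nat_of_bool (F e))).
by rewrite -big_mkcond /= sum1dep_card; apply: eq_card => e; rewrite !inE.
Qed.

Lemma place_input I : place (inX (input I)) (nedges I) = 2 ^ #|modulator I|.
Proof.
rewrite place_pow; congr (2 ^ _).
under eq_bigr => i _ do rewrite inX_input.
by rewrite sum_nth_edge; apply: eq_card => e; rewrite inE.
Qed.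

Record loaded (I : instance) (s : state) : Prop := Loaded {
  loaded_var : forall x, x < 6 -> var s x = nth 0 (input_vars I) x;
  loaded_arr : forall a i, a < 3 -> arr s a i = arr (input I) a i;
  loaded_row : forall i, i < nedges I -> arr s 3 i = i * nedges I;
  loaded_place : forall i, i < nedges I -> arr s 4 i = place (inX (input I)) i
}.

Lemma loaded_adj I s (i j : 'I_(nedges I)) : loaded I s ->
  adjn s i j = forcing I (nth_edge I i) (nth_edge I j).
Proof.
by move=> Ls; rewrite /adjn (loaded_row Ls) // (loaded_arr Ls) // adj_input.
Qed.

Lemma loaded_inX I s i : loaded I s -> inX s i = inX (input I) i.
Proof. by move=> Ls; rewrite /inX (loaded_arr Ls). Qed.

Lemma loaded_set_var I s x v : 6 <= x -> loaded I s -> loaded I (set_var x v s).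
Proof.
move=> x6 [Hv Ha Hr Hp]; split=> // y y6 /=.
by rewrite ltn_eqF ?Hv // (leq_trans y6).
Qed.

Lemma loaded_den I p s : all (leq 6) (mod_vars p) -> all (leq 5) (mod_arrs p) ->
  loaded I s -> loaded I (den p s).
Proof.
move=> /allP Hmv /allP Hma [Hv Ha Hr Hp].
have fa a i : a < 5 -> arr (den p s) a i = arr s a i.
  by move=> a5; rewrite den_arr //; apply: contraL a5 => /Hma; rewrite leqNgt.
split=> [x x6|a i a3|i lt_i|i lt_i].
- by rewrite den_var ?Hv //; apply: contraL x6 => /Hmv; rewrite leqNgt.
- by rewrite fa ?Ha // (leq_trans a3).
- by rewrite fa ?Hr.
- by rewrite fa ?Hp.
Qed.

Section SubAdj.
Variables (V : finType) (G : sgraph V).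
Implicit Types (Es Fs F : {set edge G}) (e : edge G).

Lemma sub_connectS Es Fs : Es \subset Fs ->
  subrel (connect (sub_adj Es)) (connect (sub_adj Fs)).
Proof.
move=> /subsetP EF; apply: connect_sub => u v /exists_inP[e /EF eF uv].
by apply: connect1; apply/exists_inP; exists e.
Qed.

Lemma sub_connectU1 Es e s a b : connect (sub_adj Es) s a ->
  ends e = [set a; b] -> connect (sub_adj (e |: Es)) s b.
Proof.
move=> sa ab; apply: (connect_trans (sub_connectS (subsetUr [set e] Es) sa)).
by apply: connect1; apply/exists_inP; exists e; rewrite ?setU11 ?ab.
Qed.

(** The price of [Es] on top of [F] is the size of [Es :\: F]; a new edge raises it by at most its
    length. *)
Lemma cardsU1D Es F e : #|(e |: Es) :\: F| <= #|Es :\: F| + (e \notin F).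
Proof.
rewrite setDUl; apply: leq_trans (leq_card_setU _ _) _; rewrite addnC leq_add2l.
case: (boolP (e \in F)) => [eF|_]; last first.
  by apply: leq_trans (subset_leq_card (subsetDl _ _)) _; rewrite cards1.
by rewrite leqn0 cards_eq0 setD_eq0 sub1set.
Qed.

Lemma cardsD1D Es F e : e \in Es ->
  #|(Es :\ e) :\: F| + (e \notin F) <= #|Es :\: F|.
Proof.
move=> eE; rewrite setDDl setUC -setDDl [X in _ <= X](cardsD1 e) inE eE andbT.
by rewrite addnC.
Qed.

End SubAdj.

Definition forced I s : {set edge (graph I)} :=
  [set e | arr s 7 (enum_rank e) == 0].

Lemma weightE I s (i : 'I_(nedges I)) :
  weight s i = (nth_edge I i \notin forced I s).
Proof. by rewrite /weight inE enum_valK. Qed.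

Lemma card_forced I s :
  \sum_(i < nedges I) (arr s 7 i == 0) = #|forced I s|.
Proof.
rewrite -sum_nth_edge; apply: eq_bigr => i _.
by rewrite enum_valK.
Qed.

Section Walks.
Variables (I : instance) (z : state).
Hypotheses (zm : var z 3 = nedges I) (zs : var z 1 = source I).
Hypothesis z0 : forall i, arr z 0 i = arr (input I) 0 i.

Lemma z_ends (i : 'I_(nedges I)) : exists a b : 'I_(nverts I),
  [/\ end1 z i = a, end2 z i = b & ends (nth_edge I i) = [set a; b]].
Proof.
have [a [b]] := ends_input i; exists a, b.
by rewrite /end1 /end2 !z0.
Qed.

(** A simple path uses each edge once: the last edge can be removed from [Es] before the induction,
    so no edge is charged twice. *)
Lemma path_walk (Es : {set edge (graph I)}) p :
  path (sub_adj Es) (source I) p -> uniq (source I :: p) ->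
  exists2 d, walk z (size p) (last (source I) p) d & d <= #|Es :\: forced I z|.
Proof.
elim/last_ind: p Es => [|p v IHp] Es; first by exists 0; rewrite // -zs; constructor.
rewrite rcons_path -rcons_cons rcons_uniq last_rcons size_rcons.
move=> /andP[Ep /exists_inP[e eE /eqP ends_e]] /andP[v_p Up].
have [|d W le_d] := IHp (Es :\ e) _ Up.
  apply: (sub_in_path (P := mem (source I :: p))) Ep; last exact/allP.
  move=> x y xp yp /exists_inP[f fE ends_f]; apply/exists_inP; exists f => //.
  rewrite !inE fE andbT; apply: contraTneq v_p => fe; rewrite negbK.
  have : v \in ends f by rewrite fe ends_e !inE eqxx orbT.
  by rewrite (eqP ends_f) !inE => /orP[] /eqP->.
exists (d + (e \notin forced I z)); last first.
  by apply: leq_trans (cardsD1D _ eE); rewrite leq_add2r.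
pose i := enum_rank e; have ei : nth_edge I i = e by rewrite enum_rankK.
rewrite -[in X in walk _ _ _ X]ei -weightE.
have [a [b [ea eb]]] := z_ends i; rewrite ei ends_e => E.
have lt_i : i < var z 3 by rewrite zm.
have : last (source I) p \in [set a; b] by rewrite -E !inE eqxx.
have : v \in [set a; b] by rewrite -E !inE eqxx orbT.
have ne : last (source I) p != v.
  by apply: contraNneq v_p => <-; rewrite mem_last.
rewrite !inE => /orP[] /eqP vv /orP[] /eqP ll.
- by rewrite vv ll eqxx in ne.
- by rewrite vv -ea; apply: walk_bwd => //; rewrite eb -ll.
- by rewrite vv -eb; apply: walk_fwd => //; rewrite ea -ll.
- by rewrite vv ll eqxx in ne.
Qed.

Lemma dist_sound :
  (forall x, x < nverts I -> arr z 8 x = if x == var z 1 then 0 else var z 3 + 1) ->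
  forall v : 'I_(nverts I), arr (den bellman_prog z) 8 v <= nedges I ->
  exists2 Es, connect (sub_adj Es) (source I) v &
    #|Es :\: forced I z| <= arr (den bellman_prog z) 8 v.
Proof.
(* [R] keeps an edge set instead of a walk; repeating an edge only makes the set smaller than the
   length. *)
move=> init v; pose R x d := forall v : 'I_(nverts I), v = x :> nat ->
  exists2 Es, connect (sub_adj Es) (source I) v & #|Es :\: forced I z| <= d.
move=> le_m; suff : R v (arr (den bellman_prog z) 8 v) by apply.
have step (i : 'I_(nedges I)) (a b : 'I_(nverts I)) d :
    ends (nth_edge I i) = [set a; b] -> R a d -> R b (d + weight z i).
  move=> E Ra b' /val_inj->; have [Es Ca le_d] := Ra a erefl.
  exists (nth_edge I i |: Es); first exact: sub_connectU1 Ca E.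
  by apply: leq_trans (cardsU1D _ _ _) _; rewrite weightE leq_add2r.
apply: den_bellman_sound; rewrite ?zm //.
- move=> e d lt_e; have [a [b [-> -> E]]] := z_ends (Ordinal lt_e).
  exact: (step (Ordinal lt_e)).
- move=> e d lt_e; have [a [b [-> -> E]]] := z_ends (Ordinal lt_e).
  by apply: (step (Ordinal lt_e)); rewrite setUC.
- move=> x + w xw; rewrite -xw init // zm.
  case: eqP => [ws _|_]; last by rewrite addn1 ltnn.
  exists set0; last by rewrite set0D cards0.
  by have -> : w = source I by apply: val_inj; rewrite /= ws zs.
Qed.

End Walks.

Lemma sum_bool_eq0 (T : finType) (F : pred T) :
  reflect (forall x, ~~ F x) (\sum_(x : T) F x == 0).
Proof.
rewrite sum_nat_eq0; apply: (iffP forallP) => H x; move: (H x);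
by rewrite /= bit_eq0.
Qed.

Lemma no_conflictP (m : nat) (c : nat -> nat -> bool) :
  reflect (forall i j : 'I_m, ~~ c i j)
    (\sum_(i < m) \sum_(j < m) c i j == 0).
Proof.
rewrite sum_nat_eq0; apply: (iffP forallP) => [H i j|H i].
  by have /sum_bool_eq0 := H i; apply.
by apply/sum_bool_eq0.
Qed.

Lemma budgetP (I : instance) s k : loaded I s ->
  (k%:Z <= budget I)%R = (var s 4 == 0) && (k <= var s 5).
Proof.
move=> Ls; rewrite !(loaded_var Ls) //= bit_eq0.
by apply/idP/idP; lia.
Qed.

(** * Correctness of one round *)

Lemma body_sound I s : loaded I s -> var (den body_prog s) 15 != 0 ->
  var s 15 != 0 \/ yes_instance I.
Proof.
move=> Ls; have [z [[z0 z1 z3 a0 _] _ _ init ->]] := den_body s.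
have s3 : var s 3 = nedges I by rewrite (loaded_var Ls).
have s1 : var s 1 = source I by rewrite (loaded_var Ls).
have s2 : var s 2 = target I by rewrite (loaded_var Ls).
rewrite addn_eq0 negb_and => /orP[|]; [by left | rewrite bit_eq0 negbK].
case/and4P => conf neg le_m le_b; right.
have {conf} ok := no_conflictP _ (fun i j =>
  [&& arr z 7 i != 0, arr z 7 j != 0 & adjn s i j]) conf.
rewrite s2 s3 in le_m le_b.
have [|||v|Es conn card_Es] := @dist_sound I z _ _ _ _ (target I) le_m.
- by rewrite z3.
- by rewrite z1.
- by move=> i; rewrite a0 (loaded_arr Ls).
- by rewrite z1 z3 => lt_v; apply: init; rewrite (loaded_var Ls).
exists (forced I z :|: Es); split.
- rewrite (budgetP _ Ls) neg /=; apply: leq_trans le_b.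
  have -> : forced I z :|: Es = forced I z :|: (Es :\: forced I z).
    by apply/setP => e; rewrite !in_setU in_setD; case: (e \in _).
  by rewrite card_forced; apply: leq_trans (leq_card_setU _ _) _; rewrite leq_add2l.
- exact: sub_connectS (subsetUr _ _) _ _ conn.
move=> x y xy; rewrite !inE; apply/negPn; rewrite !negb_or.
apply/negP => /andP[/andP[x7 _] /andP[y7 _]].
rewrite s3 in ok.
have /negP[] := ok (enum_rank x) (enum_rank y).
by rewrite x7 y7 (loaded_adj _ _ Ls) !enum_rankK.
Qed.

Lemma body_mono s : var s 15 != 0 -> var (den body_prog s) 15 != 0.
Proof.
by have [z [_ _ _ _ ->]] := den_body s; rewrite addn_eq0 negb_and => ->.
Qed.

(** The guess depends on the instance alone and works from every loaded state, so it does not matter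
    what earlier rounds left in memory. *)
Lemma body_complete I : yes_instance I -> exists k u v,
  [/\ k < 2 ^ #|modulator I|, u < nedges I, v < nedges I &
  forall s, loaded I s -> var s 7 = k -> var s 8 = u -> var s 9 = v ->
    var (den body_prog s) 15 != 0].
Proof.
case=> Es [card_Es /connectP[p0 path0 last0] cover].
case: (shortenP path0) last0 => p path_p uniq_p _ last_p.
pose m := nedges I.
have m_gt0 : 0 < m.
  case: p path_p last_p {uniq_p} => [_ /esym /eqP|a p].
    by rewrite (negPf (source_neq_target I)).
  (* As s and t differ, the path has a first edge. *)
  by move=> /= /andP[/exists_inP[e _ _] _] _; apply/card_gt0P; exists e.
pose g (i : 'I_m) := nth_edge I i; pose fe i j := forcing I (g i) (g j).
pose al i := g i \notin modulator I.
pose S : pred nat := fun j => [exists i : 'I_m,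
  [&& i == j :> nat, g i \in modulator I & g i \notin Es]].
have SE (i : 'I_m) : S i = (g i \in modulator I) && (g i \notin Es).
  apply/existsP/andP => [[j /and3P[/eqP/val_inj->]]|[iX iE]] //.
  by exists i; rewrite eqxx iX.
have SX j : S j -> inX (input I) j.
  by case/existsP => i /and3P[/eqP<- iX _]; rewrite inX_input.
pose indep (A : {set 'I_m}) :=
  [forall i in A, al i] && [forall i in A, forall j in A, ~~ fe i j].
pose C0 := [set i | al i & g i \notin Es].
have C0indep : indep C0.
  apply/andP; split; first by apply/forall_inP => i; rewrite inE => /andP[].
  apply/forall_inP => i; rewrite inE => /andP[_ iE].
  apply/forall_inP => j; rewrite inE => /andP[_ jE].
  by apply/negP => /cover; rewrite (negPf iE) (negPf jE).
(* The complement of [Es] outside X is independent; [J] is a maximal independent set of G_f - X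
   above it. *)
have [J /maxsetP[/andP[/forall_inP Jal Jind] Jmax] CJ] := maxset_exists C0indep.
have {}Jind i j : i \in J -> j \in J -> ~~ fe i j.
  by move=> iJ jJ; have /forall_inP/(_ i iJ)/forall_inP/(_ j jJ) := Jind.
have fe_sym : symmetric fe by move=> i j; apply: adj_sym.
have fe_irr : irreflexive fe by move=> i; apply: adj_irr.
have Jdom w : al w -> w \notin J -> exists2 y, y \in J & fe y w.
  move=> alw wJ; apply/exists_inP; apply: contraR wJ => /exists_inPn now.
  rewrite -(Jmax (w |: J)) ?setU11 ?subsetUr //; apply/andP; split.
    by apply/forall_inP => i; rewrite !inE => /predU1P[->//|/Jal].
  apply/forall_inP => i; rewrite !inE => iw.
  apply/forall_inP => j; rewrite !inE => jw.
  case/predU1P: iw => [->|iJ]; case/predU1P: jw => [->|jJ].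
  - by rewrite fe_irr.
  - by rewrite fe_sym now.
  - by rewrite now.
  - exact: Jind.
have free a b c d : al a -> al b -> al c -> al d -> fe a b -> fe c d ->
    [|| fe a c, fe a d, fe b c | fe b d].
  move=> ala alb alc ald ab cd; apply/negPn/negP.
  rewrite !negb_or => /and4P[ac ad bc bd].
  (* A coincidence among the four would make a loop or turn one of the two edges into an excluded
     one. *)
  have U : uniq [:: a; b; c; d].
    rewrite /= !inE !negb_or; do !(apply/andP; split) => //.
    - by apply: contraTneq ab => ->; rewrite fe_irr.
    - by apply: contraNneq bc => <-; rewrite fe_sym.
    - by apply: contraNneq bd => <-; rewrite fe_sym.
    - by apply: contraNneq ac => <-.
    - by apply: contraNneq ad => <-.
    - by apply: contraTneq cd => ->; rewrite fe_irr.
  rewrite -(map_inj_uniq (@enum_val_inj _ (edge (graph I)))) in U.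
  apply: (@modulatorP I).
  exists (exist _ (g a) ala), (exist _ (g b) alb).
  exists (exist _ (g c) alc), (exist _ (g d) ald).
  split; [|exact: ab|exact: cd|exact/and4P].
  by rewrite -(map_inj_uniq val_inj); exact: U.
have [u [v uvP]] := @max_indep_greedy m fe al (fun w => w \in J)
  m_gt0 fe_sym fe_irr free Jal Jind Jdom.
pose X := inX (input I).
exists (\sum_(j < m | S j) place X j), u, v; split=> //.
  by rewrite -place_input; apply: place_gt.
move=> s Ls s7 s8 s9.
have [z [[z0 z1 z3 a0 Zspec] Aspec Fspec init ->]] := den_body s.
have sm : var s 3 = m by rewrite (loaded_var Ls).
have splace i : place (inX s) i = place X i.
  by apply: place_ext => j _; apply: loaded_inX.
have Zz (i : 'I_m) : (arr z 5 i != 0) = (g i \in modulator I) && (g i \notin Es).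
  rewrite -SE; apply: Zspec; rewrite ?sm //.
  - by move=> j /SX; rewrite (loaded_inX _ Ls).
  - by move=> j lt_j; rewrite splace (loaded_place Ls).
  - by rewrite s7; apply: eq_bigr => j _.
have adjE (i j : 'I_m) : adjn s i j = fe i j by rewrite (loaded_adj _ _ Ls).
have Az (i : 'I_m) : (arr z 6 i != 0) = (i \in J).
  apply: (uvP (fun i : 'I_m => arr z 6 i != 0)) => w.
  rewrite Aspec ?sm // /greedy_cell s8 s9 sm !adjE; congr (_ && [|| _, _ | _ && _]).
    by rewrite /al -inX_input -(loaded_inX _ Ls) /inX negbK.
  apply/(sum_bool_eq0 (fun y : 'I_m =>
    [&& y < w, arr z 6 y != 0 & adjn s y w]))/forallP => H y; have := H y;
    by rewrite adjE andbA negb_and implybE.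
have Fz (i : 'I_m) : (arr z 7 i != 0) = (arr z 5 i != 0) ||
    (arr z 6 i != 0) && [forall y : 'I_m, ~~ ((arr z 5 y != 0) && fe y i)].
  rewrite Fspec ?sm //; congr (_ || _ && _).
  apply/(sum_bool_eq0 (fun y : 'I_m =>
    (arr z 5 y != 0) && adjn s y i))/forallP => H y;
    by have := H y; rewrite adjE.
(* Outside X such an edge lies in [J], and it has no neighbour in Z: the pair would be uncovered by
   [Es]. *)
have notEs (i : 'I_m) : g i \notin Es -> arr z 7 i != 0.
  move=> iE; rewrite Fz Zz iE andbT; have [//|iX] /= := boolP (_ \in _).
  rewrite Az (subsetP CJ) ?inE ?iE ?andbT //=.
  apply/forallP => y; rewrite Zz; apply/negP => /andP[/andP[_ yE]] /cover.
  by rewrite (negPf yE) (negPf iE).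
have FEs : forced I z \subset Es.
  apply/subsetP => e; rewrite inE; apply: contraLR => eE.
  by apply: notEs; rewrite /g enum_rankK.
have ok : \sum_(i < var s 3) \sum_(j < var s 3)
    [&& arr z 7 i != 0, arr z 7 j != 0 & adjn s i j] == 0.
  apply/(no_conflictP _ (fun i j =>
    [&& arr z 7 i != 0, arr z 7 j != 0 & adjn s i j])).
  rewrite sm => i j; rewrite adjE !Fz; apply/negP => /and3P[iF jF ij].
  (* Two members of Z are nonadjacent as [Es] is a cover, two of [J] by independence, and a mixed
     pair because N(Z) was removed. *)
  case/orP: iF => [iZ|/andP[iA /forallP iF]].
    case/orP: jF => [jZ|/andP[_ /forallP/(_ i)]]; last by rewrite iZ ij.
    move: iZ jZ; rewrite !Zz => /andP[_ iE] /andP[_ jE].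
    by have := cover _ _ ij; rewrite (negPf iE) (negPf jE).
  case/orP: jF => [jZ|/andP[jA _]]; first by have := iF j; rewrite jZ fe_sym ij.
  by have := Jind i j; rewrite -!Az iA jA ij => /(_ isT isT).
have [d W le_d] : exists2 d,
    walk z (size p) (target I) d & d <= #|Es :\: forced I z|.
  rewrite last_p; apply: path_walk => //; rewrite ?z3 ?z1 ?(loaded_var Ls) //.
  by move=> i; rewrite a0 (loaded_arr Ls).
have le_p : size p <= var z 0.
  have /card_uniqP := uniq_p; rewrite z0 (loaded_var Ls) //= => size_p.
  by have := max_card (mem (source I :: p)); rewrite size_p card_ord; apply: ltnW.
have le_D : arr (den bellman_prog z) 8 (target I) <= d.
  apply: den_bellman_complete W le_p.
  by rewrite z1 init ?eqxx // (loaded_var Ls) //= (loaded_var Ls).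
have st : var s 2 = target I by rewrite (loaded_var Ls).
have := card_Es; rewrite (budgetP _ Ls) => /andP[neg le_b].
have {}le_D := leq_trans le_D le_d.
rewrite addn_eq0 negb_and bit_neq0 ok neg sm st card_forced /= -/m.
apply/orP; right; apply/andP; split.
  exact: leq_trans le_D (max_card _).
(* F lies inside [Es], so the size of [Es] splits into that of F and the price of the rest. *)
apply: leq_trans le_b; rewrite -(cardsID (forced I z) Es) (setIidPr FEs).
by rewrite leq_add2l.
Qed.

Lemma card_edge_le (V : finType) (G : sgraph V) : #|edge G| <= #|V| ^ 2.
Proof.
rewrite card_sig -mulnn -card_prod.
have -> : #|[pred e in edges G]| = #|edges G| by apply: eq_card => e; rewrite inE.
exact: leq_trans (leq_imset_card _ _) (max_card _).
Qed.

Lemma nedges_le I : nedges I <= nverts I ^ 2.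
Proof. by have := card_edge_le (graph I); rewrite card_ord. Qed.

(** Needed for the running time: constants can be absorbed into powers of n only because n is at
    least 2. *)
Lemma nverts_gt1 I : 1 < nverts I.
Proof.
have := max_card (mem [set source I; target I]).
by rewrite cards2 source_neq_target card_ord.
Qed.

(** * The search loops *)

Section Flag.
Variables (I : instance) (x b : nat) (p : prog).
Hypotheses (xp : x \notin mod_vars p) (x6 : 6 <= x) (x15 : x != 15).
Hypothesis pL : forall z, loaded I z -> loaded I (den p z).

Lemma for_flag_sound s : loaded I s ->
  (forall z, loaded I z -> var (den p z) 15 != 0 ->
     var z 15 != 0 \/ yes_instance I) ->
  var (den (PFor x b p) s) 15 != 0 -> var s 15 != 0 \/ yes_instance I.
Proof.
move=> Ls p15; suff [] : loaded I (den (PFor x b p) s) /\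
  (var (den (PFor x b p) s) 15 != 0 -> var s 15 != 0 \/ yes_instance I) by [].
apply: (@den_for (fun _ z => loaded I z /\
  (var z 15 != 0 -> var s 15 != 0 \/ yes_instance I))) => //.
- move=> _ k z [Lz z15]; split; first exact: loaded_set_var.
  by rewrite /= [15 == x]eq_sym (negPf x15).
- by split=> //; left.
- move=> i z _ _ _ _ [Lz z15]; split; first exact: pL.
  by case/(p15 _ Lz) => //; right.
Qed.

Hypothesis p_mono : forall z, loaded I z ->
  var z 15 != 0 -> var (den p z) 15 != 0.

Lemma for_flag_mono s : loaded I s ->
  var s 15 != 0 -> var (den (PFor x b p) s) 15 != 0.
Proof.
move=> Ls s15; suff [] : loaded I (den (PFor x b p) s) /\
  var (den (PFor x b p) s) 15 != 0 by [].
apply: (@den_for (fun _ z => loaded I z /\ var z 15 != 0)) => //.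
- move=> _ k z [Lz z15]; split; first exact: loaded_set_var.
  by rewrite /= [15 == x]eq_sym (negPf x15).
- by move=> i z _ _ _ _ [Lz z15]; split; [apply: pL | apply: p_mono].
Qed.

Lemma for_flag_complete k0 s : loaded I s -> k0 < var s b ->
  (forall z, loaded I z ->
     (forall y, y \notin x :: mod_vars p -> var z y = var s y) ->
     var z x = k0 -> var (den p z) 15 != 0) ->
  var (den (PFor x b p) s) 15 != 0.
Proof.
move=> Ls k0b Hk; suff [_] : loaded I (den (PFor x b p) s) /\
  (k0 < var s b -> var (den (PFor x b p) s) 15 != 0) by apply.
apply: (@den_for (fun i z => loaded I z /\ (k0 < i -> var z 15 != 0))) => //.
- move=> i k z [Lz z15]; split; first exact: loaded_set_var.
  by rewrite /= [15 == x]eq_sym (negPf x15).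
- move=> i z _ zx zv _ [Lz z15]; split=> [|]; first exact: pL.
  rewrite ltnS leq_eqVlt => /predU1P[k0i|/z15]; last exact: p_mono.
  by apply: Hk; rewrite // zx.
Qed.

End Flag.

Lemma loaded_body I s : loaded I s -> loaded I (den body_prog s).
Proof. exact: loaded_den. Qed.

Lemma loaded_search1 I s : loaded I s -> loaded I (den (PFor 9 3 body_prog) s).
Proof. exact: loaded_den. Qed.

Lemma loaded_search2 I s :
  loaded I s -> loaded I (den (PFor 8 3 (PFor 9 3 body_prog)) s).
Proof. exact: loaded_den. Qed.

Lemma search_sound I s : loaded I s -> var s 15 = 0 ->
  var (den search_prog s) 15 != 0 -> yes_instance I.
Proof.
move=> Ls s15 H.
have [] : var s 15 != 0 \/ yes_instance I; [|by rewrite s15|by []].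
move: H; apply: for_flag_sound => //; first exact: loaded_search2.
move=> {s15 Ls}s Ls; apply: for_flag_sound => //; first exact: loaded_search1.
move=> {Ls}s Ls; apply: for_flag_sound => //; first exact: loaded_body.
exact: body_sound.
Qed.

Lemma search_complete I s : loaded I s -> var s 6 = 2 ^ #|modulator I| ->
  yes_instance I -> var (den search_prog s) 15 != 0.
Proof.
move=> Ls s6 /body_complete[k [u [v [lt_k lt_u lt_v Hbody]]]].
have L1 z : loaded I z -> loaded I (den (PFor 9 3 body_prog) z).
  exact: loaded_search1.
have L0 z : loaded I z -> loaded I (den body_prog z) by exact: loaded_body.
have L2 z : loaded I z -> loaded I (den (PFor 8 3 (PFor 9 3 body_prog)) z).
  exact: loaded_search2.
have M0 z : loaded I z -> var z 15 != 0 -> var (den body_prog z) 15 != 0.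
  by move=> _; apply: body_mono.
have M1 z : loaded I z -> var z 15 != 0 ->
    var (den (PFor 9 3 body_prog) z) 15 != 0.
  exact: for_flag_mono.
have M2 z : loaded I z -> var z 15 != 0 ->
    var (den (PFor 8 3 (PFor 9 3 body_prog)) z) 15 != 0.
  exact: for_flag_mono.
apply: (for_flag_complete (k0 := k) _ _ _ L2 M2 Ls) => //; first by rewrite s6.
move=> z Lz _ z7; apply: (for_flag_complete (k0 := u) _ _ _ L1 M1 Lz) => //.
  by rewrite (loaded_var Lz).
move=> y Ly yv y8; apply: (for_flag_complete (k0 := v) _ _ _ L0 M0 Ly) => //.
  by rewrite (loaded_var Ly).
by move=> w Lw wv w9; apply: Hbody; rewrite // wv // yv.
Qed.

(** * Assembly and running time *)

Definition prepare_prog := PSeq row_prog place_prog.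

Lemma loaded_prepare I (s := den prepare_prog (input I)) :
  [/\ loaded I s, var s 6 = 2 ^ #|modulator I| & var s 15 = 0].
Proof.
pose s1 := den row_prog (input I).
have sE : s = den place_prog s1 by rewrite /s denSeq.
have [p6 p4] := den_place s1; rewrite -sE in p6 p4.
have m1 : var s1 3 = nedges I by rewrite den_var.
have X1 j : inX s1 j = inX (input I) j by rewrite /inX den_arr.
split.
- split=> [x|a i|i lt_i|i lt_i].
  + by case: x => [|[|[|[|[|[|]]]]]] // _; rewrite sE den_var // /s1 den_var.
  + by case: a => [|[|[|]]] // _; rewrite sE den_arr // /s1 den_arr.
  + by rewrite sE den_arr // den_row.
  + by rewrite p4 ?m1 //; apply: place_ext.
- rewrite p6 m1 -place_input; exact: place_ext.
- by rewrite sE den_var // /s1 den_var.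
Qed.

(** Split because [wf] forbids assigning a loop bound: variable 6 is computed before it bounds the
    search, and variable 0 is a bound until the answer overwrites it. *)
Definition solve_cmd :=
  Seq (compile prepare_prog)
    (Seq (compile search_prog) (Assign 0 (ENot (ENot (Var 15))))).

Lemma prepare_time f N : 0 < N -> (forall b, f b <= N) ->
  time f prepare_prog <= 60 * N.
Proof. by move=> N0 fN; have := time_depth prepare_prog N0 fN; rewrite expn1. Qed.

Lemma search_time (f : nat -> nat) N : 0 < N -> f 0 <= N -> f 3 <= N ->
  time f search_prog <= f 6 * (594 * N ^ 4 + 9) + 7.
Proof.
(* The inner loops read only bounds 0 and 3; [h] drops the exponential bound 6, which would spoil a
   uniform [N]. *)
move=> N0 f0 f3; pose h b := if b == 0 then f 0 else if b == 3 then f 3 else 0.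
have hN b : h b <= N by rewrite /h; case: ifP => // _; case: ifP.
have := time_depth (PFor 8 3 (PFor 9 3 body_prog)) N0 hN.
have -> : time h (PFor 8 3 (PFor 9 3 body_prog)) =
          time f (PFor 8 3 (PFor 9 3 body_prog)) by [].
have -> : time (fun=> 1) (PFor 8 3 (PFor 9 3 body_prog)) = 594 by vm_compute.
have -> : depth (PFor 8 3 (PFor 9 3 body_prog)) = 4 by [].
move=> le_t; rewrite [time f search_prog]/(_ * (_ + 9) + 7).
by rewrite leq_add2r leq_mul2l leq_add2r le_t orbT.
Qed.

(** Four nested loops with bounds at most n ^ 2 give n ^ 8; the remaining n ^ 10 is at least 1024
    and absorbs all constants. The 6 is the cost of the final assignment. *)
Lemma total_time n K t1 t2 : 1 < n -> 0 < K -> t1 <= 60 * n ^ 2 ->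
  t2 <= K * (594 * (n ^ 2) ^ 4 + 9) + 7 ->
  (t1 + (t2 + 6).+1).+1 <= K * n ^ 18.
Proof.
move=> n1 K0 le1 le2; rewrite -expnM in le2.
have -> : n ^ 18 = n ^ 10 * n ^ 8 by rewrite -expnD.
have le10 : 2 ^ 10 <= n ^ 10 by rewrite leq_exp2r.
have n0 : 0 < n by apply: ltnW.
have le28 : n ^ 2 <= n ^ 8 by rewrite leq_pexp2l.
have n8 : 0 < n ^ 8 by rewrite expn_gt0 n0.
apply: (@leq_trans (K * (2 ^ 10 * n ^ 8))); last first.
  by rewrite leq_mul2l leq_mul2r le10 !orbT.
have K8 : n ^ 8 <= K * n ^ 8 by rewrite leq_pmull.
have -> : 2 ^ 10 = 1024 by [].
rewrite mulnCA; move: le1 le2 le28; rewrite mulnDr mulnCA.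
have KK : K <= K * n ^ 8 by rewrite leq_pmulr.
by move: (n ^ 2) (n ^ 8) (K * n ^ 8) n8 K8 KK => *; lia.
Qed.

Theorem theorem5 :
  exists (P : cmd) (c : nat), forall I : instance,
    solves_within P I (2 ^ #|modulator I| * nverts I ^ c).
Proof.
exists solve_cmd, 18 => I.
set s1 := den prepare_prog (input I); have [L1 s1_6 s1_15] := loaded_prepare I.
rewrite -/s1 in L1 s1_6 s1_15; set s2 := den search_prog s1.
pose N := nverts I ^ 2; have n1 := nverts_gt1 I.
have N0 : 0 < N by rewrite expn_gt0 (ltnW n1).
have nN : nverts I <= N by rewrite /N expnS expn1 leq_pmulr ?(ltnW n1).
have mN := nedges_le I; rewrite -/N in mN.
pose f b := if b == 0 then nverts I else if b == 3 then nedges I else 0.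
have [||t1 le1 ex1] := @exec_compile [:: 0; 3] f prepare_prog (input I).
- by [].
- by move=> b; rewrite !inE => /orP[] /eqP->.
have [||t2 le2 ex2] := @exec_compile [:: 0; 3; 6] (var s1) search_prog s1.
- by [].
- by [].
have fN b : f b <= N by rewrite /f; case: ifP => // _; case: ifP.
have {}le1 := leq_trans le1 (prepare_time N0 fN).
have {}le2 : t2 <= 2 ^ #|modulator I| * (594 * N ^ 4 + 9) + 7.
  rewrite -s1_6; apply: leq_trans le2 _.
  by apply: search_time; rewrite // (loaded_var L1).
pose e := ENot (ENot (Var 15)).
have eE : eval s2 e = (var s2 15 != 0) by rewrite /e !evalE.
exists (t1 + (t2 + (cost e).+1).+1).+1, (set_var 0 (eval s2 e) s2); split.
- exact: exec_seq ex1 (exec_seq ex2 (exec_assign 0 e _)).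
- by have := total_time n1 _ le1 le2; apply; rewrite expn_gt0.
- move=> /(search_complete L1 s1_6) yes.
  by rewrite /accepting var_set eE yes.
- move=> no; rewrite /rejecting var_set eE.
  by apply/eqP; rewrite bit_eq0; apply: contra_notN no; apply: search_sound.
Qed.
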